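(* Let $R$ be any ring with identity. The following hold. (1) If $L$ is a level chain complex of (left) $R$-modules, then $\overline{\mathrm{Tor}}_n(X,L)=0$ for all $n>0$ and all chain complexes $X$ of right $R$-modules of type $FP_\infty$. (2) The class of level chain complexes is closed under pure subcomplexes and pure quotients (quotients by pure subcomplexes). (3) The class of level chain complexes is resolving; that is, it contains the projective chain complexes and is closed under extensions and kernels of epimorphisms (i.e. if $0\to L'\to L\to L''\to 0$ is exact with $L, L''$ level, then $L'$ is level). (4) The class of level chain complexes is closed under direct products, direct sums, retracts, direct limits, and transfinite extensions.
   Context: $R$-modules are left $R$-modules unless stated otherwise; $\mathrm{Ch}(R)$ is the category of ($\mathbb{Z}$-graded, unbounded) chain complexes of left $R$-modules, with differentials lowering degree. A chain complex is finitely generated if it is bounded and finitely generated in each degree. A chain complex of (left or right) modules is of type $FP_\infty$ if it has a projective resolution by finitely generated projective complexes (projective objects of the category of chain complexes). For a complex $X$ of right $R$-modules and a complex $Y$ of left $R$-modules, let $X\otimes Y$ be the usual tensor product of complexes. The modified tensor product $X\overline{\otimes}Y$ is the complex of abelian groups whose degree $n$ entry is $(X\otimes Y)_n/B_n(X\otimes Y)$, where $B_n$ denotes the boundaries, with differential $\overline{x\otimes y}\mapsto \overline{dx\otimes y}$. It is right exact in each variable, and its left derived functors are denoted $\overline{\mathrm{Tor}}_i$. A chain complex $L$ of left $R$-modules is level if $\overline{\mathrm{Tor}}_1(X,L)=0$ for all chain complexes $X$ of right $R$-modules of type $FP_\infty$. A short exact sequence of chain complexes is pure exact if it remains exact after applying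 $\mathrm{Hom}_{\mathrm{Ch}(R)}(F,-)$ for every finitely presented complex $F$. A subcomplex $P\subseteq X$ is pure if $0\to P\to X\to X/P\to 0$ is pure exact. Given a collection $\mathcal{D}$ of chain complexes, $X$ is a transfinite extension of objects in $\mathcal{D}$ if there is an ordinal $\lambda$ and a colimit-preserving functor $X_{(-)} : \lambda \to \mathrm{Ch}(R)$ with $X_0 \in \mathcal{D}$ such that each map $X_i \to X_{i+1}$ is a monomorphism whose cokernel is in $\mathcal{D}$, and such that $\mathrm{colim}_{i<\lambda} X_i \cong X$. *)

(* Defs.v *)
From HB Require Import structures.
From mathcomp Require Import all_boot all_order all_algebra.
From mathcomp Require Import boolp wochoice.
From mathcomp Require Import freeg.

Set Implicit Arguments.
Unset Strict Implicit.
Unset Printing Implicit Defensive.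

Import Order.TTheory GRing.Theory.
Local Open Scope ring_scope.
Local Open Scope quotient_scope.

Definition span_pred (V : zmodType) (S : V -> Prop) : {pred V} :=
  fun x => `[< forall I : zmodClosed V, (forall s, S s -> s \in I) -> x \in I >].

Lemma span_zmod_closed (V : zmodType) (S : V -> Prop) :
  zmod_closed (span_pred S).
Proof.
split=> [|x y /asboolP Sx /asboolP Sy]; apply/asboolP => I SI.
  exact: rpred0.
by rewrite rpredB ?Sx ?Sy.
Qed.

HB.instance Definition _ (V : zmodType) (S : V -> Prop) :=
  GRing.isZmodClosed.Build V (span_pred S) (span_zmod_closed S).

Definition span (V : zmodType) (S : V -> Prop) : zmodClosed V := span_pred S.

Lemma span_gen (V : zmodType) (S : V -> Prop) s : S s -> s \in span S.
Proof. by move=> Ss; apply/asboolP => I; apply. Qed.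

Definition image_pred (A B : zmodType) (f : {additive A -> B}) : {pred B} :=
  fun y => `[< exists x, f x = y >].

Lemma image_zmod_closed (A B : zmodType) (f : {additive A -> B}) :
  zmod_closed (image_pred f).
Proof.
split=> [|_ _ /asboolP[x <-] /asboolP[y <-]]; apply/asboolP.
  by exists 0; rewrite raddf0.
by exists (x - y); rewrite raddfB.
Qed.

HB.instance Definition _ (A B : zmodType) (f : {additive A -> B}) :=
  GRing.isZmodClosed.Build B (image_pred f) (image_zmod_closed f).

Definition image_of (A B : zmodType) (f : {additive A -> B}) : zmodClosed B :=
  image_pred f.

Section QuotientLift.
Context (V B : zmodType) (I : zmodClosed V).

Definition qpi : {additive V -> Quotient.quot I} := \pi_(Quotient.quot I).

Lemma qpi_surj (z : Quotient.quot I) : exists x, qpi x = z.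
Proof. by exists (repr z); rewrite /qpi /= reprK. Qed.

Lemma qpi_eq0 x : (qpi x == 0) = (x \in I).
Proof. by rewrite -(raddf0 qpi) /qpi /= -Quotient.idealrBE subr0. Qed.

Context (f : {additive V -> B}) (fI : forall x, x \in I -> f x = 0).

Definition qlift_fun (z : Quotient.quot I) : B := f (repr z).

Lemma qlift_funE x : qlift_fun (qpi x) = f x.
Proof.
apply/eqP; rewrite -subr_eq0 -raddfB; apply/eqP/fI.
by rewrite -qpi_eq0 raddfB /qpi /= reprK subrr.
Qed.

Lemma qlift_zmod_morphism : zmod_morphism qlift_fun.
Proof.
move=> x y; have [[x' <-] [y' <-]] := (qpi_surj x, qpi_surj y).
by rewrite -raddfB !qlift_funE raddfB.
Qed.

HB.instance Definition _ :=
  GRing.isZmodMorphism.Build (Quotient.quot I) B qlift_fun qlift_zmod_morphism.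

(** Locked so that simplification does not expose [repr]. *)
Definition qlift : {additive Quotient.quot I -> B} :=
  locked (qlift_fun : {additive Quotient.quot I -> B}).

Lemma qliftE x : qlift (qpi x) = f x.
Proof. by rewrite /qlift -lock; exact: qlift_funE. Qed.

End QuotientLift.

(** Abelian groups presented by a set [G] of generators and a set [S] of
    relators. *)
Section Presentation.
Context (G : choiceType) (S : {freeg G} -> Prop).

Definition pres : zmodType := Quotient.quot (span S).

Definition pres_pi : {additive {freeg G} -> pres} := qpi (span S).

Definition pgen (x : G) : pres := pres_pi << x >>.

Lemma pres_pi_eq0 s : S s -> pres_pi s = 0.
Proof. by move=> Ss; apply/eqP; rewrite qpi_eq0; apply: span_gen. Qed.

Context (B : zmodType) (f : G -> B).

Definition fglift_fun : {freeg G} -> B := fglift (f : G -> zmodule B).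

HB.instance Definition _ :=
  GRing.isZmodMorphism.Build {freeg G} B fglift_fun
    (lift_is_additive (f : G -> zmodule B)).

Definition fglift_add : {additive {freeg G} -> B} := fglift_fun.

Lemma fglift_addE x : fglift_add << x >> = f x.
Proof.
by rewrite /fglift_add /= /fglift_fun liftU (scale1r (f x : zmodule B)).
Qed.

Hypothesis fS : forall s, S s -> fglift_add s = 0.

Lemma pres_lift_subproof x : x \in span S -> fglift_add x = 0.
Proof.
pose K : {pred {freeg G}} := fun s => fglift_add s == 0.
have KP : zmod_closed K.
  split=> [|a b]; rewrite !unfold_in /K ?raddf0 // => /eqP a0 /eqP b0.
  by rewrite raddfB a0 b0 subrr.
pose cK := GRing.isZmodClosed.Build _ K KP.
pose sK : zmodClosed {freeg G} := HB.pack K cK.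
by move=> /asboolP/(_ sK) h; apply/eqP/h => s /fS s0; apply/eqP.
Qed.

Definition pres_lift : {additive pres -> B} := qlift pres_lift_subproof.

Lemma pres_liftE x : pres_lift (pgen x) = f x.
Proof. by rewrite /pres_lift /pgen qliftE fglift_addE. Qed.

End Presentation.

Lemma pres_ind (G : choiceType) (S : {freeg G} -> Prop) (P : pres S -> Prop) :
  P 0 -> (forall a b, P a -> P b -> P (a - b)) -> (forall x, P (pgen S x)) ->
  forall z, P z.
Proof.
move=> P0 PB Pgen z; have [w <-] := qpi_surj z.
have PN a : P a -> P (- a) by move=> Pa; rewrite -[- a]add0r; apply: PB.
have PD a b : P a -> P b -> P (a + b).
  by move=> Pa Pb; rewrite -[b]opprK; apply: PB => //; apply: PN.
rewrite -[w]freeg_sumE raddf_sum /=.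
elim: (dom w) => [|x s IHs]; first by rewrite big_nil.
rewrite big_cons; apply/PD => //.
have -> : << coeff x w *g x >> = << x >> *~ coeff x w.
  by rewrite freegU_mulz intz.
rewrite raddfMz; case: (coeff x w) => n.
  elim: n => [|n IHn]; first by rewrite mulr0z.
  by rewrite -pmulrn mulrS; apply/PD; [exact: Pgen | rewrite pmulrn].
rewrite NegzE mulrNz; apply/PN.
elim: n.+1 => [|m IHm]; first by rewrite mulr0z.
by rewrite -pmulrn mulrS; apply/PD; [exact: Pgen | rewrite pmulrn].
Qed.

(** The direct sum of a family of abelian groups, presented by the disjoint
    union of the underlying sets subject to additivity in each summand. *)
Section DirectSum.
Context (I : choiceType) (A : I -> zmodType).

Variant dsum_rel : {freeg {i & A i}} -> Prop :=
  DsumB i (a b : A i) :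
    dsum_rel (<< Tagged A (a - b) >> - (<< Tagged A a >> - << Tagged A b >>)).

Definition dsum : zmodType := pres dsum_rel.

Definition dsum_inj_fun i (a : A i) : dsum := pgen dsum_rel (Tagged A a).

Lemma dsum_inj_zmod_morphism i : zmod_morphism (@dsum_inj_fun i).
Proof.
by by move=> a b; apply/eqP; rewrite -subr_eq0 -!raddfB; apply/eqP/pres_pi_eq0/DsumB.
Qed.

HB.instance Definition _ i :=
  GRing.isZmodMorphism.Build (A i) dsum (@dsum_inj_fun i)
    (dsum_inj_zmod_morphism (i := i)).

Definition dsum_inj i : {additive A i -> dsum} := @dsum_inj_fun i.

Lemma dsum_ind (P : dsum -> Prop) :
  P 0 -> (forall a b, P a -> P b -> P (a - b)) ->
  (forall i (a : A i), P (dsum_inj i a)) -> forall z, P z.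
Proof. by move=> P0 PB Pinj; apply: pres_ind => // -[i a]; exact: Pinj. Qed.

Context (B : zmodType) (f : forall i, {additive A i -> B}).

Lemma dsum_lift_subproof s :
  dsum_rel s -> fglift_add (fun u : {i & A i} => f (tag u) (tagged u)) s = 0.
Proof.
by case=> i a b; rewrite 2!raddfB !fglift_addE /= raddfB subrr.
Qed.

Definition dsum_lift : {additive dsum -> B} := pres_lift dsum_lift_subproof.

Lemma dsum_liftE i a : dsum_lift (dsum_inj i a) = f i a.
Proof. exact: pres_liftE. Qed.

End DirectSum.

(** The tensor product of a right and a left module. A right [R]-module is a
    left module over the converse ring [R^c]: the right action [x a] is written
    [(a : R^c) *: x]. *)
Section Tensor.
Context (R : pzRingType) (M : lmodType R^c) (N : lmodType R).

Variant tensor_rel : {freeg (M * N)%type} -> Prop :=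
| TensorBl x x' y :
    tensor_rel (<< (x - x', y) >> - (<< (x, y) >> - << (x', y) >>))
| TensorBr x y y' :
    tensor_rel (<< (x, y - y') >> - (<< (x, y) >> - << (x, y') >>))
| TensorZ x (a : R) y :
    tensor_rel (<< ((a : R^c) *: x, y) >> - << (x, a *: y) >>).

Definition tensor : zmodType := pres tensor_rel.

Definition tens (x : M) (y : N) : tensor := pgen tensor_rel (x, y).

Lemma tensBl x x' y : tens (x - x') y = tens x y - tens x' y.
Proof.
by apply/eqP; rewrite -subr_eq0 -!raddfB; apply/eqP/pres_pi_eq0/TensorBl.
Qed.

Lemma tensBr x y y' : tens x (y - y') = tens x y - tens x y'.
Proof.
by apply/eqP; rewrite -subr_eq0 -!raddfB; apply/eqP/pres_pi_eq0/TensorBr.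
Qed.

Lemma tensZ x (a : R) y : tens ((a : R^c) *: x) y = tens x (a *: y).
Proof.
by apply/eqP; rewrite -subr_eq0 -!raddfB; apply/eqP/pres_pi_eq0/TensorZ.
Qed.

Lemma tens0l y : tens 0 y = 0.
Proof. by rewrite -(subrr (0 : M)) tensBl subrr. Qed.

Lemma tens0r x : tens x 0 = 0.
Proof. by rewrite -(subrr (0 : N)) tensBr subrr. Qed.

Lemma tensor_ind (P : tensor -> Prop) :
  P 0 -> (forall a b, P a -> P b -> P (a - b)) ->
  (forall x y, P (tens x y)) -> forall z, P z.
Proof. by move=> P0 PB Pt; apply: pres_ind => // -[x y]; exact: Pt. Qed.

Definition balanced (B : zmodType) (f : M -> N -> B) :=
  [/\ forall x x' y, f (x - x') y = f x y - f x' y,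
      forall x y y', f x (y - y') = f x y - f x y'
    & forall x (a : R) y, f ((a : R^c) *: x) y = f x (a *: y)].

Context (B : zmodType) (f : M -> N -> B) (fP : balanced f).

Lemma tensor_lift_subproof s :
  tensor_rel s -> fglift_add (fun u : M * N => f u.1 u.2) s = 0.
Proof.
case: fP => fBl fBr fZ.
case=> [x x' y|x y y'|x a y].
- by rewrite 2!raddfB !fglift_addE fBl subrr.
- by rewrite 2!raddfB !fglift_addE fBr subrr.
- by rewrite raddfB !fglift_addE fZ subrr.
Qed.

Definition tensor_lift : {additive tensor -> B} :=
  pres_lift tensor_lift_subproof.

Lemma tensor_liftE x y : tensor_lift (tens x y) = f x y.
Proof. exact: pres_liftE. Qed.

End Tensor.

Section Homology.
Context (A B C : zmodType) (f : {additive A -> B}) (g : {additive B -> C}).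

Definition ker_pred : {pred B} := fun x => g x == 0.

Lemma ker_zmod_closed : zmod_closed ker_pred.
Proof.
split=> [|x y]; rewrite !unfold_in /ker_pred ?raddf0 // => /eqP x0 /eqP y0.
by rewrite raddfB x0 y0 subrr.
Qed.

HB.instance Definition _ := GRing.isZmodClosed.Build B ker_pred ker_zmod_closed.

Record kernel := Kernel { kernel_val :> B; _ : kernel_val \in ker_pred }.

HB.instance Definition _ := [isSub for kernel_val].
HB.instance Definition _ := [Choice of kernel by <:].
HB.instance Definition _ := [SubChoice_isSubZmodule of kernel by <:].

Definition bound_pred : {pred kernel} := fun z => val z \in image_of f.

Lemma bound_zmod_closed : zmod_closed bound_pred.
Proof.
split=> [|x y hx hy].
  by change (val (0 : kernel) \in image_of f); rewrite raddf0 rpred0.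
change (val (x - y) \in image_of f).
by rewrite raddfB; apply: rpredB; [exact: hx | exact: hy].
Qed.

HB.instance Definition _ :=
  GRing.isZmodClosed.Build kernel bound_pred bound_zmod_closed.

Definition homology : zmodType :=
  Quotient.quot (bound_pred : zmodClosed kernel).

End Homology.

(** The differential [X i -> X j] exists for each [i] and [j] related by a proof
    of [j + 1 = i]; such a proof is unique, so there is exactly one differential
    out of each degree. Indexing by both degrees avoids transports between, say,
    degrees [n + 1 - 1] and [n]. *)

Record abcomplex := AbComplex {
  ab_obj :> int -> zmodType;
  ab_d : forall i j : int, j + 1 = i -> {additive ab_obj i -> ab_obj j};
  ab_dd : forall i j k (h : j + 1 = i) (h' : k + 1 = j) x,
    ab_d h' (ab_d h x) = 0
}.

Section Complexes.
Context (R : pzRingType).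

Record chcomplex := ChComplex {
  ch_obj :> int -> lmodType R;
  ch_d : forall i j : int, j + 1 = i -> {linear ch_obj i -> ch_obj j};
  ch_dd : forall i j k (h : j + 1 = i) (h' : k + 1 = j) x,
    ch_d h' (ch_d h x) = 0
}.

Record chmap (X Y : chcomplex) := ChMap {
  ch_fun :> forall n, {linear X n -> Y n};
  ch_funP : forall i j (h : j + 1 = i) x,
    ch_fun j (ch_d X h x) = ch_d Y h (ch_fun i x)
}.

End Complexes.

Section CategoryOfComplexes.
Context (R : pzRingType).
Implicit Types (X Y Z : chcomplex R).

Definition eq_chmap X Y (f g : chmap X Y) := forall n x, f n x = g n x.

(** [comp_is g f h] : the composite of [f] followed by [g] is [h]. *)
Definition comp_is X Y Z (g : chmap Y Z) (f : chmap X Y) (h : chmap X Z) :=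
  forall n x, g n (f n x) = h n x.

Definition comp_is0 X Y Z (g : chmap Y Z) (f : chmap X Y) :=
  forall n x, g n (f n x) = 0.

Definition injective_chmap X Y (f : chmap X Y) := forall n, injective (f n).

Definition surjective_chmap X Y (f : chmap X Y) :=
  forall n y, exists x, f n x = y.

Definition exact_chmap X Y Z (f : chmap X Y) (g : chmap Y Z) :=
  forall n y, g n y = 0 <-> exists x, f n x = y.

Definition short_exact X Y Z (f : chmap X Y) (g : chmap Y Z) :=
  [/\ injective_chmap f, exact_chmap f g & surjective_chmap g].

Definition projective_cx (P : chcomplex R) :=
  forall Y Z (g : chmap Y Z) (f : chmap P Z),
    surjective_chmap g -> exists h : chmap P Y, comp_is g h f.

Definition fingen_module (M : lmodType R) :=
  exists (k : nat) (e : 'I_k -> M),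
    forall x, exists c : 'I_k -> R, x = \sum_(i < k) c i *: e i.

Definition bounded_cx X :=
  exists N : nat, forall n : int, (N < `|n|)%N -> forall x : X n, x = 0.

Definition fingen_cx X := bounded_cx X /\ forall n, fingen_module (X n).

Record proj_resolution X := ProjResolution {
  res_obj :> nat -> chcomplex R;
  res_d : forall i, chmap (res_obj i.+1) (res_obj i);
  res_aug : chmap (res_obj 0) X;
  res_proj : forall i, projective_cx (res_obj i);
  res_aug_surj : surjective_chmap res_aug;
  res_exact0 : exact_chmap (res_d 0) res_aug;
  res_exact : forall i, exact_chmap (res_d i.+1) (res_d i)
}.

Definition FPinfty X :=
  exists P : proj_resolution X, forall i, fingen_cx (P i).

Definition finpres_cx X :=
  exists (P1 P0 : chcomplex R) (d : chmap P1 P0) (e : chmap P0 X),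
    [/\ projective_cx P1 /\ fingen_cx P1, projective_cx P0 /\ fingen_cx P0,
        exact_chmap d e & surjective_chmap e].

Definition Hom_short_exact (F : chcomplex R) X Y Z
    (f : chmap X Y) (g : chmap Y Z) :=
  [/\ forall (u v : chmap F X) (w : chmap F Y),
        comp_is f u w -> comp_is f v w -> eq_chmap u v,
      forall v : chmap F Y,
        comp_is0 g v <-> exists u : chmap F X, comp_is f u v
    & forall w : chmap F Z, exists v : chmap F Y, comp_is g v w].

Definition pure_exact X Y Z (f : chmap X Y) (g : chmap Y Z) :=
  short_exact f g /\
  forall F : chcomplex R, finpres_cx F -> Hom_short_exact F f g.

Definition retract X Y :=
  exists (i : chmap X Y) (r : chmap Y X), forall n x, r n (i n x) = x.

Definition is_product (I : Type) (L : I -> chcomplex R) X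
    (p : forall i, chmap X (L i)) :=
  forall T (t : forall i, chmap T (L i)),
    exists u : chmap T X, (forall i, comp_is (p i) u (t i)) /\
      forall v : chmap T X, (forall i, comp_is (p i) v (t i)) -> eq_chmap v u.

Definition is_coproduct (I : Type) (L : I -> chcomplex R) X
    (s : forall i, chmap (L i) X) :=
  forall T (t : forall i, chmap (L i) T),
    exists u : chmap X T, (forall i, comp_is u (s i) (t i)) /\
      forall v : chmap X T, (forall i, comp_is v (s i) (t i)) -> eq_chmap v u.

Record diagram (d : Order.disp_t) (I : preorderType d) := Diagram {
  dg_obj :> I -> chcomplex R;
  dg_map : forall i j : I, (i <= j)%O -> chmap (dg_obj i) (dg_obj j);
  dg_id : forall i (h : (i <= i)%O) n x, dg_map h n x = x;
  dg_comp : forall i j k (h : (i <= j)%O) (h' : (j <= k)%O) (h'' : (i <= k)%O),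
    comp_is (dg_map h') (dg_map h) (dg_map h'')
}.

Section Colimits.
Context (d : Order.disp_t) (I : preorderType d) (D : diagram I).

(** Cocones and colimits are those of the restriction of the diagram to the
    subset [S] of [I]. *)
Definition cocone_on (S : {pred I}) X (c : forall i, i \in S -> chmap (D i) X) :=
  forall i j (Si : i \in S) (Sj : j \in S) (h : (i <= j)%O),
    comp_is (c j Sj) (dg_map D h) (c i Si).

Definition is_colimit_on (S : {pred I}) X
    (c : forall i, i \in S -> chmap (D i) X) :=
  cocone_on c /\
  forall T (t : forall i, i \in S -> chmap (D i) T), cocone_on t ->
    exists u : chmap X T, (forall i Si, comp_is u (c i Si) (t i Si)) /\
      forall v : chmap X T,
        (forall i Si, comp_is v (c i Si) (t i Si)) -> eq_chmap v u.

Definition is_colimit X :=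
  exists c : forall i, i \in (predT : {pred I}) -> chmap (D i) X,
    is_colimit_on c.

Definition directed :=
  inhabited I /\ forall i j : I, exists k, (i <= k)%O /\ (j <= k)%O.

End Colimits.

Section Transfinite.
Context (d : Order.disp_t) (I : orderType d) (D : diagram I).

Definition is_least (i : I) := forall j : I, (i <= j)%O.

Definition is_succ (i j : I) :=
  (i < j)%O /\ forall k : I, (i < k)%O -> (j <= k)%O.

Definition is_limit (i : I) :=
  (exists j : I, (j < i)%O) /\
  forall j : I, (j < i)%O -> exists k : I, (j < k)%O /\ (k < i)%O.

(** As usual, the colimits to be preserved are those at the limit ordinals. *)
Definition colimit_preserving :=
  forall i : I, is_limit i ->
    is_colimit_on (S := [pred j | (j < i)%O])
      (fun j (h : (j < i)%O) => dg_map D (ltW h)).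

End Transfinite.

(** Ordinals are represented by well-ordered types. *)
Definition transfinite_extension (C : chcomplex R -> Prop) X :=
  exists (d : Order.disp_t) (I : orderType d) (D : diagram I),
    [/\ well_order (<=%O : rel I),
        exists i0 : I, is_least i0 /\ C (D i0),
        colimit_preserving D,
        forall (i j : I) (h : (i <= j)%O), is_succ i j ->
          exists (Q : chcomplex R) (q : chmap (D j) Q),
            short_exact (dg_map D h) q /\ C Q
      & is_colimit D X].

End CategoryOfComplexes.

Section ModifiedTensor.

Definition boundaries (A : abcomplex) (n : int) : zmodClosed (A n) :=
  image_of (ab_d A (erefl (n + 1))).

Lemma boundariesP (A : abcomplex) i j (h : j + 1 = i) z :
  reflect (exists x, ab_d A h x = z) (z \in boundaries A j).
Proof. by case: i / h; apply: asboolP. Qed.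

Lemma predl_subproof (n m : int) (hn : m + 1 = n) (i j : int) : i + j = n -> i - 1 + j = m.
Proof. by move=> h; apply: (addIr 1); rewrite hn addrAC subrK. Qed.

Lemma predr_subproof (n m : int) (hn : m + 1 = n) (i j : int) : i + j = n -> i + (j - 1) = m.
Proof. by move=> h; apply: (addIr 1); rewrite hn addrA subrK. Qed.

Context (R : pzRingType) (X : chcomplex R^c) (Y : chcomplex R).
Implicit Types (n m k i j : int).

(** The index set of the summands [X i (x) Y j], [i + j = n], in degree [n]. *)
Definition bideg (n : int) := {p : int * int | p.1 + p.2 == n}.

Definition Bideg n i j (h : i + j = n) : bideg n :=
  exist _ (i, j) (introT eqP h).

Definition tens_ob (n : int) : zmodType :=
  dsum (fun k : bideg n => tensor (X (val k).1) (Y (val k).2)).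

(** The element [x (x) y] of degree [n], for [x] of degree [i] and [y] of
    degree [j]. *)
Definition tens_el n i j (h : i + j = n) (x : X i) (y : Y j) : tens_ob n :=
  dsum_inj (fun k : bideg n => tensor (X (val k).1) (Y (val k).2))
    (Bideg h) (tens x y).

Lemma tens_ob_ind n (P : tens_ob n -> Prop) :
  P 0 -> (forall a b, P a -> P b -> P (a - b)) ->
  (forall i j (h : i + j = n) x y, P (tens_el h x y)) -> forall z, P z.
Proof.
move=> P0 PB Pe; apply: dsum_ind => // -[[i j] /= hij].
apply: tensor_ind => [|a b Pa Pb|x y]; rewrite ?raddf0 ?raddfB //; first exact: PB.
have := Pe i j (eqP hij) x y; rewrite /tens_el /Bideg.
by rewrite (bool_irrelevance (introT eqP (eqP hij)) hij).
Qed.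

Section Lift.
Context (n : int) (B : zmodType).
Context (f : forall i j, i + j = n -> X i -> Y j -> B).
Hypothesis fP : forall i j (h : i + j = n), balanced (f h).

Definition tens_ob_lift : {additive tens_ob n -> B} :=
  dsum_lift (fun k : bideg n => tensor_lift (fP (eqP (valP k)))).

Lemma tens_ob_liftE i j (h : i + j = n) x y :
  tens_ob_lift (tens_el h x y) = f h x y.
Proof.
rewrite /tens_ob_lift /tens_el dsum_liftE tensor_liftE /=.
by rewrite (eq_irrelevance (eqP _) h).
Qed.

End Lift.

Lemma tens_el_balanced n i j (h : i + j = n) : balanced (tens_el h).
Proof.
by split=> *; rewrite /tens_el ?tensBl ?tensBr ?tensZ ?raddfB.
Qed.

Section Differential.
Context (n m : int) (hn : m + 1 = n).

(** [dx (x) y] and [x (x) dy]. *)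
Definition tens_dl_fun i j (h : i + j = n) (x : X i) (y : Y j) : tens_ob m :=
  tens_el (predl_subproof hn h) (ch_d X (subrK 1 i) x) y.

Definition tens_dr_fun i j (h : i + j = n) (x : X i) (y : Y j) : tens_ob m :=
  tens_el (predr_subproof hn h) x (ch_d Y (subrK 1 j) y).

Definition tens_d_fun i j (h : i + j = n) (x : X i) (y : Y j) : tens_ob m :=
  tens_dl_fun h x y + tens_dr_fun h x y *~ (-1) ^+ `|i|%N.

Lemma tens_dl_balanced i j (h : i + j = n) : balanced (tens_dl_fun h).
Proof.
have [eBl eBr eZ] := tens_el_balanced (predl_subproof hn h).
by split=> *; rewrite /tens_dl_fun ?raddfB ?linearZ ?eBl ?eBr ?eZ.
Qed.

Lemma tens_dr_balanced i j (h : i + j = n) : balanced (tens_dr_fun h).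
Proof.
have [eBl eBr eZ] := tens_el_balanced (predr_subproof hn h).
by split=> *; rewrite /tens_dr_fun ?raddfB ?linearZ ?eBl ?eBr ?eZ.
Qed.

Lemma tens_d_balanced i j (h : i + j = n) : balanced (tens_d_fun h).
Proof.
have [lBl lBr lZ] := tens_dl_balanced h.
have [rBl rBr rZ] := tens_dr_balanced h.
split=> *; rewrite /tens_d_fun ?lBl ?lBr ?lZ ?rBl ?rBr ?rZ //.
  by rewrite mulrzBl addrACA opprD.
by rewrite mulrzBl addrACA opprD.
Qed.

Definition tens_d : {additive tens_ob n -> tens_ob m} :=
  tens_ob_lift tens_d_balanced.

Definition tens_dl : {additive tens_ob n -> tens_ob m} :=
  tens_ob_lift tens_dl_balanced.

Lemma tens_dlE i j (h : i + j = n) i' (hi : i' + 1 = i) (h' : i' + j = m) x y :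
  tens_dl (tens_el h x y) = tens_el h' (ch_d X hi x) y.
Proof.
rewrite tens_ob_liftE /tens_dl_fun.
have e : i - 1 = i' by rewrite -hi addrK.
case: i' / e hi h' => hi h'.
by rewrite (eq_irrelevance hi (subrK 1 i)) (eq_irrelevance h' (predl_subproof hn h)).
Qed.

Lemma tens_dE i j (h : i + j = n) i' (hi : i' + 1 = i) j' (hj : j' + 1 = j)
    (hl : i' + j = m) (hr : i + j' = m) x y :
  tens_d (tens_el h x y) =
    tens_el hl (ch_d X hi x) y + tens_el hr x (ch_d Y hj y) *~ (-1) ^+ `|i|%N.
Proof.
rewrite -(tens_dlE h) tens_ob_liftE /tens_d_fun tens_ob_liftE.
congr (_ + _ *~ _); rewrite /tens_dr_fun.
have e : j - 1 = j' by rewrite -hj addrK.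
case: j' / e hj hr => hj hr.
by rewrite (eq_irrelevance hj (subrK 1 j)) (eq_irrelevance hr (predr_subproof hn h)).
Qed.

End Differential.

Lemma tens_el0l n i j (h : i + j = n) (y : Y j) : tens_el h 0 y = 0.
Proof. by rewrite /tens_el tens0l raddf0. Qed.

Lemma tens_el0r n i j (h : i + j = n) (x : X i) : tens_el h x 0 = 0.
Proof. by rewrite /tens_el tens0r raddf0. Qed.

Lemma sign_pred (i : int) : (-1) ^+ `|i - 1|%N = - (-1) ^+ `|i|%N :> int.
Proof.
case: i => [[|n]|n]; first by [].
  have -> : Posz n.+1 - 1 = n by rewrite intS addrC addKr.
  by rewrite /= exprS mulN1r opprK.
have -> : Negz n - 1 = Negz n.+1 by rewrite !NegzE (intS n.+1) opprD addrC.
by rewrite /= (exprS _ n.+1) mulN1r.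
Qed.

Lemma tens_dd n m k (h : m + 1 = n) (h' : k + 1 = m) z :
  tens_d h' (tens_d h z) = 0.
Proof.
elim/tens_ob_ind: z => [|a b a0 b0|i j hij x y]; first by rewrite !raddf0.
  by rewrite !raddfB a0 b0 subrr.
have hll := predl_subproof h' (predl_subproof h hij).
have hlr := predr_subproof h' (predl_subproof h hij).
have hrr := predr_subproof h' (predr_subproof h hij).
rewrite (tens_dE h hij (subrK 1 i) (subrK 1 j) (predl_subproof h hij)
  (predr_subproof h hij)) raddfD raddfMz /=.
rewrite (tens_dE h' _ (subrK 1 (i - 1)) (subrK 1 j) hll hlr).
rewrite (tens_dE h' _ (subrK 1 i) (subrK 1 (j - 1)) hlr hrr).
rewrite !ch_dd tens_el0l tens_el0r add0r mul0rz addr0 sign_pred mulrNz.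
by rewrite addNr.
Qed.

Definition tens_cx : abcomplex := AbComplex tens_dd.

(** [dx (x) dy] being a boundary, [x (x) y |-> dx (x) y] preserves
    boundaries. *)
Lemma tens_dl_boundaries n m (h : m + 1 = n) z :
  z \in boundaries tens_cx n -> tens_dl h z \in boundaries tens_cx m.
Proof.
case/asboolP => w <- /=.
elim/tens_ob_ind: w => [|a b|i j hij x y]; first by rewrite !raddf0 rpred0.
  by rewrite !raddfB; apply: rpredB.
have hl := predl_subproof (erefl (n + 1)) hij.
have hr := predr_subproof (erefl (n + 1)) hij.
have hll := predl_subproof h hl.
have hlr := predr_subproof h hl.
rewrite (tens_dE _ hij (subrK 1 i) (subrK 1 j) hl hr) raddfD raddfMz /=.
rewrite (tens_dlE h hl (subrK 1 (i - 1)) hll) ch_dd tens_el0l add0r.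
rewrite (tens_dlE h hr (subrK 1 i) hlr) rpredMz //.
apply/(boundariesP (A := tens_cx) h); exists (tens_el hr x (ch_d Y (subrK 1 j) y)).
have hrr := predr_subproof h hr.
rewrite /= (tens_dE h hr (subrK 1 i) (subrK 1 (j - 1)) hlr hrr).
by rewrite ch_dd tens_el0r mul0rz addr0.
Qed.

(** The modified tensor product: [(X (x) Y)_n / B_n(X (x) Y)] in degree [n], with
    differential induced by [x (x) y |-> dx (x) y]. *)
Definition tensbar_ob (n : int) : zmodType := Quotient.quot (boundaries tens_cx n).

Lemma tensbar_d_subproof n m (h : m + 1 = n) z :
  z \in boundaries tens_cx n -> (qpi (boundaries tens_cx m) \o tens_dl h) z = 0.
Proof. by move=> /(tens_dl_boundaries h); rewrite -qpi_eq0 => /eqP. Qed.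

Definition tensbar_d n m (h : m + 1 = n) : {additive tensbar_ob n -> tensbar_ob m} :=
  qlift (@tensbar_d_subproof n m h).

Lemma tensbar_dd n m k (h : m + 1 = n) (h' : k + 1 = m) z :
  tensbar_d h' (tensbar_d h z) = 0.
Proof.
have [w <-] := qpi_surj z; rewrite /tensbar_d qliftE [X in qlift _ X]/= qliftE /=.
rewrite (_ : tens_dl h' _ = 0) ?raddf0 //.
elim/tens_ob_ind: w => [|a b a0 b0|i j hij x y]; first by rewrite !raddf0.
  by rewrite !raddfB a0 b0 subrr.
have hl := predl_subproof h hij.
have hll := predl_subproof h' hl.
by rewrite (tens_dlE h hij (subrK 1 i) hl) (tens_dlE h' hl (subrK 1 (i - 1)) hll)
  ch_dd tens_el0l.
Qed.

Definition tensbar : abcomplex := AbComplex tensbar_dd.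

End ModifiedTensor.

Section ModifiedTensorMap.
Context (R : pzRingType) (X X' : chcomplex R^c) (f : chmap X X').
Context (Y : chcomplex R).
Implicit Types (n m i j : int).

Definition tens_map_fun n i j (h : i + j = n) (x : X i) (y : Y j) : tens_ob X' Y n :=
  tens_el h (f i x) y.

Lemma tens_map_balanced n i j (h : i + j = n) : balanced (tens_map_fun h).
Proof.
have [eBl eBr eZ] := tens_el_balanced X' Y h.
by split=> *; rewrite /tens_map_fun ?raddfB ?linearZ ?eBl ?eBr ?eZ.
Qed.

Definition tens_map n : {additive tens_ob X Y n -> tens_ob X' Y n} :=
  tens_ob_lift (tens_map_balanced (n := n)).

Lemma tens_mapE n i j (h : i + j = n) x y :
  tens_map n (tens_el h x y) = tens_el h (f i x) y.
Proof. exact: tens_ob_liftE. Qed.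

Lemma tens_map_d n m (h : m + 1 = n) z :
  tens_map m (tens_d X Y h z) = tens_d X' Y h (tens_map n z).
Proof.
elim/tens_ob_ind: z => [|a b ha hb|i j hij x y]; first by rewrite !raddf0.
  by rewrite !raddfB ha hb.
have hl := predl_subproof h hij.
have hr := predr_subproof h hij.
rewrite tens_mapE !(tens_dE h hij (subrK 1 i) (subrK 1 j) hl hr).
by rewrite (raddfD (tens_map m)) (raddfMz (tens_map m)) 2!tens_mapE ch_funP.
Qed.

Lemma tensbar_map_subproof n z :
  z \in boundaries (tens_cx X Y) n ->
  (qpi (boundaries (tens_cx X' Y) n) \o tens_map n) z = 0.
Proof.
case/asboolP => w <- /=; apply/eqP; rewrite qpi_eq0 tens_map_d.
by apply/asboolP; exists (tens_map _ w).
Qed.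

Definition tensbar_map n : {additive tensbar X Y n -> tensbar X' Y n} :=
  qlift (@tensbar_map_subproof n).

End ModifiedTensorMap.

Section Level.
Context (R : pzRingType).

Section Tor.
Context (X : chcomplex R^c) (P : proj_resolution X) (L : chcomplex R).

(** Degree [m] of the complex of abelian groups [Tor_i(X, L)], computed from the
    projective resolution [P] of [X]: homology in a category of complexes is
    computed degreewise. For [i = 0] the second map is
    [P_0 (x) L -> 0], represented by the zero endomorphism. *)
Definition torbar (i : nat) (m : int) : zmodType :=
  match i with
  | 0 => homology (tensbar_map (res_d P 0) L m)
           (GRing.null_fun (tensbar (P 0) L m))
  | i'.+1 => homology (tensbar_map (res_d P i'.+1) L m)
               (tensbar_map (res_d P i') L m)
  end.

End Tor.

(** [Tor_i(X, L) = 0]: up to isomorphism, [Tor_i(X, L)] does not depend on the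
    projective resolution of [X]. *)
Definition torbar_vanishes (i : nat) (X : chcomplex R^c) (L : chcomplex R) :=
  forall (P : proj_resolution X) (m : int) (t : torbar P L i m), t = 0.

Definition level (L : chcomplex R) :=
  forall X : chcomplex R^c, FPinfty X -> torbar_vanishes 1 X L.

End Level.

(* Main.v *)
(** Tor is computed from any projective resolution, so by the comparison theorem
    [L] is level iff tensoring with [L] preserves exactness of every sequence
    [... -> P_2 -> P_1 -> P_0] of finitely generated projective complexes which
    is exact away from [P_0]; this gives (1) by shifting. A finitely generated
    projective [P] is a direct summand of a finite product of disks [D^n(R)],
    and the degree [m] part of the modified tensor product of [D^n(R)] and [Y]
    is [Y_(m - n)]. So [P (x) Y] is, naturally in [Y], a direct summand of a
    finite product of terms of [Y]: it is exact in [Y] and commutes with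
    products, coproducts and direct limits, whence (3) and (4).

    For (2), the natural map from [P_1 (x) -] to [P_0 (x) -] comes, by Yoneda,
    from a map of left complexes with a finitely presented cokernel [F]. Lifting
    maps out of [F] along a pure epimorphism [L -> L / A] shows that an element
    of [P_0 (x) A] whose image in [P_0 (x) L] comes from [P_1 (x) L] already
    comes from [P_1 (x) A]. *)

From HB Require Import structures.
Require Import Defs.
From mathcomp Require Import all_boot all_order all_algebra.
From mathcomp Require Import boolp wochoice zify.

Set Implicit Arguments.
Unset Strict Implicit.
Unset Printing Implicit Defensive.

Import Order.TTheory GRing.Theory.
Local Open Scope ring_scope.

(** * Modules *)

(** Two obstacles shape the proof. [torbar_vanishes] quantifies over all projective resolutions,
    which need not be finitely generated, whereas tensoring is controlled only on finitely generated
    projectives; so each resolution is compared with a finitely generated one. Moreover products,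
    coproducts and colimits are given by universal properties, which mention no elements. An element
    of degree [q] is therefore traded for a map out of the disk $D^q(R)$, and a claim that all
    elements have a certain form is drawn from uniqueness: such elements form a subcomplex, and the
    projection modulo this subcomplex agrees with zero on all structure maps.

    Closure under kernels involves $\overline{\mathrm{Tor}}_2$ of the quotient, so levelness has to
    be exploited along a whole chain and not only at its end. Projectives are level for a reason of
    their own: tensoring a chain with $D^q(R)$ returns, in each degree, a graded piece of the chain
    itself, which is exact; and every projective complex is a retract of a direct sum of disks. *)

Section Submodule.
Context (R : pzRingType) (M : lmodType R) (S : submodClosed M).

Record submodule := Submodule { submodule_val :> M; _ : submodule_val \in S }.

HB.instance Definition _ := [isSub for submodule_val].
HB.instance Definition _ := [Choice of submodule by <:].
HB.instance Definition _ := [SubChoice_isSubLmodule of submodule by <:].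

End Submodule.

Section ClassicalSubmodule.
Context (R : pzRingType) (M : lmodType R) (S : M -> Prop).
Hypothesis S0 : S 0.
Hypothesis SL : forall (a : R) x y, S x -> S y -> S (a *: x + y).

Definition Prop_pred : {pred M} := fun x => `[< S x >].

Lemma Prop_pred_submod_closed : submod_closed Prop_pred.
Proof.
split=> [|a x y /asboolP Sx /asboolP Sy]; apply/asboolP => //.
exact: SL.
Qed.

(** Images, kernels and conditions such as eventual vanishing are propositions, hence the passage
    through classical booleans. *)
Definition submod_of_Prop : submodClosed M :=
  HB.pack Prop_pred (GRing.isSubmodClosed.Build R M Prop_pred Prop_pred_submod_closed).

End ClassicalSubmodule.

Section QuotientModule.
Context (R : pzRingType) (M : lmodType R) (S : submodClosed M).

Definition submod_pred : {pred M} := fun x => x \in S.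

Lemma submod_zmod_closed : zmod_closed submod_pred.
Proof. exact: GRing.submod_closedB (submodClosedP S). Qed.

Definition submod_zmodClosed : zmodClosed M :=
  HB.pack submod_pred (GRing.isZmodClosed.Build M submod_pred submod_zmod_closed).

Definition quotmod : Type := Quotient.quot submod_zmodClosed.

HB.instance Definition _ := GRing.Zmodule.on quotmod.

Definition quotmod_pi : M -> quotmod := qpi submod_zmodClosed.

Lemma quotmod_scale_subproof (a : R) x :
  x \in submod_zmodClosed -> (qpi submod_zmodClosed \o ( *:%R a)) x = 0.
Proof. by move=> Sx; apply/eqP; rewrite qpi_eq0; apply: (rpredZ (s := S)). Qed.

Definition quotmod_scale (a : R) : quotmod -> quotmod :=
  qlift (@quotmod_scale_subproof a).

Lemma quotmod_scaleE a x : quotmod_scale a (quotmod_pi x) = quotmod_pi (a *: x).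
Proof. exact: qliftE. Qed.

Lemma quotmod_pi_surj z : exists x, quotmod_pi x = z.
Proof. exact: qpi_surj. Qed.

Lemma quotmod_piD : {morph quotmod_pi : x y / x + y}.
Proof. exact: (raddfD (qpi submod_zmodClosed)). Qed.

Lemma quotmod_scaleA a b v :
  quotmod_scale a (quotmod_scale b v) = quotmod_scale (a * b) v.
Proof.
by have [x <-] := quotmod_pi_surj v; rewrite !quotmod_scaleE scalerA.
Qed.

Lemma quotmod_scale1 : left_id 1 quotmod_scale.
Proof.
by move=> v; have [x <-] := quotmod_pi_surj v; rewrite quotmod_scaleE scale1r.
Qed.

Lemma quotmod_scaleDr : right_distributive quotmod_scale +%R.
Proof. by move=> a u v; rewrite /quotmod_scale raddfD. Qed.

Lemma quotmod_scaleDl v : {morph quotmod_scale^~ v : a b / a + b}.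
Proof.
move=> a b; have [x <-] := quotmod_pi_surj v.
by rewrite !quotmod_scaleE scalerDl quotmod_piD.
Qed.

HB.instance Definition _ := GRing.Zmodule_isLmodule.Build R quotmod
  quotmod_scaleA quotmod_scale1 quotmod_scaleDr quotmod_scaleDl.

Lemma quotmod_pi_linear : linear quotmod_pi.
Proof. by move=> a x y; rewrite quotmod_piD -quotmod_scaleE. Qed.

HB.instance Definition _ :=
  GRing.isLinear.Build R M quotmod *:%R quotmod_pi quotmod_pi_linear.

Lemma quotmod_pi_eq0 x : (quotmod_pi x = 0) <-> (x \in S).
Proof.
split=> [/eqP|xS]; first by rewrite qpi_eq0.
by apply/eqP; rewrite qpi_eq0.
Qed.

Context (N : lmodType R) (f : {linear M -> N}).
Hypothesis fS : forall x, x \in S -> f x = 0.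

Definition quotmod_lift : quotmod -> N := qlift (fS : forall x, x \in submod_zmodClosed -> f x = 0).

Lemma quotmod_liftE x : quotmod_lift (quotmod_pi x) = f x.
Proof. exact: qliftE. Qed.

Lemma quotmod_lift_linear : linear quotmod_lift.
Proof.
move=> a u v; have [[x <-] [y <-]] := (quotmod_pi_surj u, quotmod_pi_surj v).
by rewrite -linearP !quotmod_liftE linearP.
Qed.

HB.instance Definition _ :=
  GRing.isLinear.Build R quotmod N *:%R quotmod_lift quotmod_lift_linear.

End QuotientModule.

Section ProductModule.
Context (R : pzRingType) (I : Type) (M : I -> lmodType R).

Definition prodmod : Type := forall i, M i.

HB.instance Definition _ := Choice.on prodmod.

Definition prodmod_zero : prodmod := fun=> 0.
Definition prodmod_opp (x : prodmod) : prodmod := fun i => - x i.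
Definition prodmod_add (x y : prodmod) : prodmod := fun i => x i + y i.
Definition prodmod_scale (a : R) (x : prodmod) : prodmod := fun i => a *: x i.

Lemma prodmod_addA : associative prodmod_add.
Proof. by move=> x y z; apply: functional_extensionality_dep => i; apply: addrA. Qed.

Lemma prodmod_addC : commutative prodmod_add.
Proof. by move=> x y; apply: functional_extensionality_dep => i; apply: addrC. Qed.

Lemma prodmod_add0 : left_id prodmod_zero prodmod_add.
Proof. by move=> x; apply: functional_extensionality_dep => i; apply: add0r. Qed.

Lemma prodmod_addN : left_inverse prodmod_zero prodmod_opp prodmod_add.
Proof. by move=> x; apply: functional_extensionality_dep => i; apply: addNr. Qed.

HB.instance Definition _ := GRing.isZmodule.Build prodmod
  prodmod_addA prodmod_addC prodmod_add0 prodmod_addN.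

Lemma prodmod_scaleA a b x :
  prodmod_scale a (prodmod_scale b x) = prodmod_scale (a * b) x.
Proof. by apply: functional_extensionality_dep => i; apply: scalerA. Qed.

Lemma prodmod_scale1 : left_id 1 prodmod_scale.
Proof. by move=> x; apply: functional_extensionality_dep => i; apply: scale1r. Qed.

Lemma prodmod_scaleDr : right_distributive prodmod_scale +%R.
Proof. by move=> a x y; apply: functional_extensionality_dep => i; apply: scalerDr. Qed.

Lemma prodmod_scaleDl x : {morph prodmod_scale^~ x : a b / a + b}.
Proof. by move=> a b; apply: functional_extensionality_dep => i; apply: scalerDl. Qed.

HB.instance Definition _ := GRing.Zmodule_isLmodule.Build R prodmod
  prodmod_scaleA prodmod_scale1 prodmod_scaleDr prodmod_scaleDl.

Definition prodmod_proj i (x : prodmod) : M i := x i.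

Lemma prodmod_proj_linear i : linear (@prodmod_proj i).
Proof. by []. Qed.

HB.instance Definition _ i :=
  GRing.isLinear.Build R prodmod (M i) *:%R (@prodmod_proj i)
    (@prodmod_proj_linear i).

Context (N : lmodType R) (f : forall i, {linear N -> M i}).

Definition prodmod_tuple (x : N) : prodmod := fun i => f i x.

Lemma prodmod_tuple_linear : linear prodmod_tuple.
Proof. by move=> a x y; apply: functional_extensionality_dep => i; apply: linearP. Qed.

HB.instance Definition _ :=
  GRing.isLinear.Build R N prodmod *:%R prodmod_tuple prodmod_tuple_linear.

End ProductModule.

Section DirectSumModule.
Context (R : pzRingType) (I : choiceType) (M : I -> lmodType R).

Definition dsummod : Type := dsum M.

HB.instance Definition _ := GRing.Zmodule.on dsummod.

(** The group [dsum] is given by generators and relations, so the action is defined by the universal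
    property and its axioms are checked on the images of the summands. *)
Definition dsummod_scale (a : R) : dsummod -> dsummod :=
  dsum_lift (fun i => dsum_inj M i \o ( *:%R a)).

Definition dsummod_inj i : M i -> dsummod := dsum_inj M i.

Lemma dsummod_injD i : {morph @dsummod_inj i : x y / x + y}.
Proof. exact: (raddfD (dsum_inj M i)). Qed.

Lemma dsummod_scaleE a i x : dsummod_scale a (@dsummod_inj i x) = dsummod_inj (a *: x).
Proof. exact: dsum_liftE. Qed.

Lemma dsummod_scaleB a : {morph dsummod_scale a : x y / x - y}.
Proof. by move=> x y; rewrite /dsummod_scale raddfB. Qed.

Lemma dsummod_scale0 a : dsummod_scale a 0 = 0.
Proof. by rewrite /dsummod_scale raddf0. Qed.

Lemma dsummod_scaleA a b v :
  dsummod_scale a (dsummod_scale b v) = dsummod_scale (a * b) v.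
Proof.
elim/dsum_ind: v => [|u v IHu IHv|i x]; first by rewrite !dsummod_scale0.
  by rewrite !dsummod_scaleB IHu IHv.
by rewrite !dsummod_scaleE scalerA.
Qed.

Lemma dsummod_scale1 : left_id 1 dsummod_scale.
Proof.
move=> v; elim/dsum_ind: v => [|u v IHu IHv|i x]; first by rewrite !dsummod_scale0.
  by rewrite !dsummod_scaleB IHu IHv.
by rewrite !dsummod_scaleE scale1r.
Qed.

Lemma dsummod_scaleDr : right_distributive dsummod_scale +%R.
Proof. by move=> a u v; rewrite /dsummod_scale raddfD. Qed.

Lemma dsummod_scaleDl v : {morph dsummod_scale^~ v : a b / a + b}.
Proof.
move=> a b; elim/dsum_ind: v => [|u v IHu IHv|i x].
- by rewrite !dsummod_scale0 addr0.
- by rewrite !dsummod_scaleB IHu IHv addrACA opprD.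
- by rewrite !dsummod_scaleE scalerDl dsummod_injD.
Qed.

HB.instance Definition _ := GRing.Zmodule_isLmodule.Build R dsummod
  dsummod_scaleA dsummod_scale1 dsummod_scaleDr dsummod_scaleDl.

Lemma dsummod_inj_linear i : linear (@dsummod_inj i).
Proof. by move=> a x y; rewrite dsummod_injD -dsummod_scaleE. Qed.

HB.instance Definition _ i :=
  GRing.isLinear.Build R (M i) dsummod *:%R (@dsummod_inj i)
    (@dsummod_inj_linear i).

Definition dsummod_linj i : {linear M i -> dsummod} := @dsummod_inj i.

Lemma dsummod_ind (P : dsummod -> Prop) :
  P 0 -> (forall u v, P u -> P v -> P (u - v)) ->
  (forall i x, P (dsummod_linj i x)) -> forall v, P v.
Proof. exact: dsum_ind. Qed.

Context (N : lmodType R) (f : forall i, {linear M i -> N}).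

Definition dsummod_lift : dsummod -> N := dsum_lift f.

Lemma dsummod_liftB : {morph dsummod_lift : x y / x - y}.
Proof. exact: (raddfB (dsum_lift f)). Qed.

Lemma dsummod_liftE i x : dsummod_lift (dsummod_linj i x) = f i x.
Proof. exact: dsum_liftE. Qed.

Lemma dsummod_lift_linear : linear dsummod_lift.
Proof.
move=> a u v; rewrite -[v in LHS]opprK dsummod_liftB; congr (_ + _); last first.
  by rewrite -[- v]sub0r dsummod_liftB /dsummod_lift raddf0 sub0r opprK.
elim/dsum_ind: u => [|x y IHx IHy|i x].
- by rewrite scaler0 /dsummod_lift raddf0 scaler0.
- by rewrite scalerBr !dsummod_liftB IHx IHy scalerBr.
- by rewrite -[dsum_inj _ _ x]/(dsummod_linj i x) -linearZ !dsummod_liftE linearZ.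
Qed.

HB.instance Definition _ :=
  GRing.isLinear.Build R dsummod N *:%R dsummod_lift dsummod_lift_linear.

End DirectSumModule.

(** * Complexes *)

(** Full choice for a dependent family, obtained from [cid]; despite the name it is not the axiom of
    dependent choice. *)
Lemma dep_choice (T : Type) (U : T -> Type) (P : forall t, U t -> Prop) :
  (forall t, exists u, P t u) -> exists f : forall t, U t, forall t, P t (f t).
Proof.
by move=> PU; exists (fun t => projT1 (cid (PU t))) => t; case: (cid (PU t)).
Qed.

Section LinearOf.
Context (R : pzRingType) (M N : lmodType R) (f : M -> N).

Definition linear_of (lf : linear f) : {linear M -> N} :=
  HB.pack f (GRing.isLinear.Build R M N *:%R f lf).

End LinearOf.

Section ChMaps.
Context (R : pzRingType).
Implicit Types (X Y Z : chcomplex R).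

Definition chmap_of X Y (f : forall n, X n -> Y n) (lf : forall n, linear (f n))
    (fd : forall i j (h : j + 1 = i) x, f j (ch_d X h x) = ch_d Y h (f i x)) :
  chmap X Y := @ChMap R X Y (fun n => linear_of (lf n)) fd.

Definition ch_id X : chmap X X := @ChMap R X X (fun n => idfun) (fun _ _ _ _ => erefl).

Lemma ch_comp_subproof X Y Z (g : chmap Y Z) (f : chmap X Y) i j (h : j + 1 = i) x :
  (g j \o f j) (ch_d X h x) = ch_d Z h ((g i \o f i) x).
Proof. by rewrite /= !ch_funP. Qed.

Definition ch_comp X Y Z (g : chmap Y Z) (f : chmap X Y) : chmap X Z :=
  @ChMap R X Z (fun n => g n \o f n) (ch_comp_subproof g f).

Lemma ch_zero_subproof X Y i j (h : j + 1 = i) x :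
  @GRing.null_fun (X j) (Y j) (ch_d X h x) = ch_d Y h (\0 x).
Proof. by rewrite /= raddf0. Qed.

Definition ch_zero X Y : chmap X Y := @ChMap R X Y (fun n => \0) (@ch_zero_subproof X Y).

Lemma ch_sub_subproof X Y (f g : chmap X Y) i j (h : j + 1 = i) x :
  (f j \- g j) (ch_d X h x) = ch_d Y h ((f i \- g i) x).
Proof. by rewrite /= !ch_funP raddfB. Qed.

Definition ch_sub X Y (f g : chmap X Y) : chmap X Y :=
  @ChMap R X Y (fun n => f n \- g n) (ch_sub_subproof f g).

Section Sum.
Context X Y (T : finType) (f : T -> chmap X Y).

Lemma ch_sum_linear n : linear (fun x => \sum_t f t n x).
Proof.
move=> a x y; rewrite scaler_sumr -big_split /=.
by apply: eq_bigr => t _; rewrite linearP.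
Qed.

Lemma ch_sum_subproof i j (h : j + 1 = i) x :
  \sum_t f t j (ch_d X h x) = ch_d Y h (\sum_t f t i x).
Proof. by rewrite raddf_sum; apply: eq_bigr => t _; rewrite ch_funP. Qed.

Definition ch_sum : chmap X Y := chmap_of ch_sum_linear ch_sum_subproof.

End Sum.

(** The differential and the identity as total families of maps between any
    two degrees, zero where the degrees do not match. *)
Definition ch_tr X i j : {linear X i -> X j} :=
  match i =P j with
  | ReflectT e => match e in _ = k return {linear X i -> X k} with erefl => idfun end
  | ReflectF _ => \0
  end.

Definition ch_dt X i j : {linear X i -> X j} :=
  match j + 1 =P i with ReflectT h => ch_d X h | ReflectF _ => \0 end.

Lemma ch_trE X i (x : X i) : ch_tr X i i x = x.
Proof. by rewrite /ch_tr; case: eqP => // e; rewrite (eq_irrelevance e erefl). Qed.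

Lemma ch_tr_neq X i j (x : X i) : i <> j -> ch_tr X i j x = 0.
Proof. by rewrite /ch_tr; case: eqP. Qed.

Lemma ch_dtE X i j (h : j + 1 = i) (x : X i) : ch_dt X i j x = ch_d X h x.
Proof. by rewrite /ch_dt; case: eqP => // e; rewrite (eq_irrelevance e h). Qed.

Lemma ch_dt_neq X i j (x : X i) : j + 1 <> i -> ch_dt X i j x = 0.
Proof. by rewrite /ch_dt; case: eqP. Qed.

Lemma ch_fun_tr X Y (f : chmap X Y) i j x : f j (ch_tr X i j x) = ch_tr Y i j (f i x).
Proof.
have [<-|/eqP ij] := eqVneq i j; first by rewrite !ch_trE.
by rewrite !ch_tr_neq // raddf0.
Qed.

Lemma ch_fun_dt X Y (f : chmap X Y) i j x : f j (ch_dt X i j x) = ch_dt Y i j (f i x).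
Proof.
have [h|/eqP ij] := eqVneq (j + 1) i; first by rewrite !(ch_dtE h) ch_funP.
by rewrite !ch_dt_neq // raddf0.
Qed.

Lemma ch_d_tr X q i j (h : j + 1 = i) (x : X q) :
  ch_d X h (ch_tr X q i x) = ch_dt X q j x.
Proof.
have [e|/eqP qi] := eqVneq q i; first by case: i / e h => h; rewrite ch_trE (ch_dtE h).
by rewrite ch_tr_neq // raddf0 ch_dt_neq // h => /esym.
Qed.

Lemma ch_d_dt X q i j (h : j + 1 = i) (x : X q) : ch_d X h (ch_dt X q i x) = 0.
Proof.
have [e|/eqP qi] := eqVneq (i + 1) q; first by rewrite (ch_dtE e) ch_dd.
by rewrite ch_dt_neq // raddf0.
Qed.

End ChMaps.

Lemma int_addr1_neq (n : int) : n + 1 <> n.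
Proof. by move/eqP; rewrite -subr_eq0 addrAC subrr add0r. Qed.

(** * Subcomplexes, quotients, cokernels, kernels and lifting *)

Section SubComplex.
Context (R : pzRingType) (X : chcomplex R) (S : forall n, submodClosed (X n)).
Hypothesis dS : forall i j (h : j + 1 = i) x, x \in S i -> ch_d X h x \in S j.

Definition subcx_d_fun i j (h : j + 1 = i) (x : submodule (S i)) : submodule (S j) :=
  Submodule (dS h (valP x)).

Lemma subcx_d_linear i j (h : j + 1 = i) : linear (subcx_d_fun h).
Proof. by move=> a x y; apply: val_inj; rewrite /= !linearP. Qed.

Lemma subcx_dd i j k (h : j + 1 = i) (h' : k + 1 = j) x :
  linear_of (subcx_d_linear h') (linear_of (subcx_d_linear h) x) = 0.
Proof. by apply: val_inj; rewrite /= ch_dd. Qed.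

Definition subcx : chcomplex R := ChComplex subcx_dd.

Context (Y : chcomplex R) (f : chmap Y X) (fS : forall n y, f n y \in S n).

Lemma subcx_lift_linear n : linear (fun y : Y n => Submodule (fS y) : subcx n).
Proof. by move=> a x y; apply: val_inj; rewrite /= linearP. Qed.

Lemma subcx_lift_subproof i j (h : j + 1 = i) x :
  Submodule (fS (ch_d Y h x)) = ch_d subcx h (Submodule (fS x)).
Proof. by apply: val_inj; rewrite /= ch_funP. Qed.

Definition subcx_lift : chmap Y subcx := chmap_of subcx_lift_linear subcx_lift_subproof.

End SubComplex.

Section QuotientComplex.
Context (R : pzRingType) (X : chcomplex R) (S : forall n, submodClosed (X n)).
Hypothesis dS : forall i j (h : j + 1 = i) x, x \in S i -> ch_d X h x \in S j.

Lemma quotcx_d_subproof i j (h : j + 1 = i) x :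
  x \in S i -> (quotmod_pi (S j) \o ch_d X h) x = 0.
Proof. by move=> Sx; apply/quotmod_pi_eq0/dS. Qed.

Definition quotcx_d i j (h : j + 1 = i) : {linear quotmod (S i) -> quotmod (S j)} :=
  quotmod_lift (@quotcx_d_subproof i j h).

Lemma quotcx_dd i j k (h : j + 1 = i) (h' : k + 1 = j) x :
  quotcx_d h' (quotcx_d h x) = 0.
Proof.
have [y <-] := quotmod_pi_surj x.
by rewrite /quotcx_d /= quotmod_liftE /= quotmod_liftE /= ch_dd raddf0.
Qed.

Definition quotcx : chcomplex R := ChComplex quotcx_dd.

Lemma quotcx_pi_subproof i j (h : j + 1 = i) x :
  quotmod_pi (S j) (ch_d X h x) = ch_d quotcx h (quotmod_pi (S i) x).
Proof. by rewrite /= quotmod_liftE. Qed.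

Definition quotcx_pi : chmap X quotcx :=
  @ChMap R X quotcx (fun n => quotmod_pi (S n)) quotcx_pi_subproof.

Lemma quotcx_pi_surj : surjective_chmap quotcx_pi.
Proof. by move=> n z; apply: quotmod_pi_surj. Qed.

Lemma quotcx_pi_eq0 n x : quotcx_pi n x = 0 <-> x \in S n.
Proof. exact: quotmod_pi_eq0. Qed.

Context (Y : chcomplex R) (f : chmap X Y) (fS : forall n x, x \in S n -> f n x = 0).

Lemma quotcx_lift_subproof i j (h : j + 1 = i) z :
  quotmod_lift (fS (n := j)) (ch_d quotcx h z)
    = ch_d Y h (quotmod_lift (fS (n := i)) z).
Proof.
have [x <-] := quotcx_pi_surj z.
by rewrite -ch_funP /= !quotmod_liftE ch_funP.
Qed.

Definition quotcx_lift : chmap quotcx Y :=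
  @ChMap R quotcx Y (fun n => quotmod_lift (fS (n := n))) quotcx_lift_subproof.

Lemma quotcx_liftE n x : quotcx_lift n (quotcx_pi n x) = f n x.
Proof. exact: quotmod_liftE. Qed.

End QuotientComplex.

Section Cokernel.
Context (R : pzRingType) (X Y : chcomplex R) (f : chmap X Y).

Definition img n (y : Y n) := exists x, f n x = y.

Lemma img0 n : img (0 : Y n).
Proof. by exists 0; rewrite raddf0. Qed.

Lemma imgL n (a : R) (y z : Y n) : img y -> img z -> img (a *: y + z).
Proof. by move=> [u <-] [v <-]; exists (a *: u + v); rewrite linearP. Qed.

Definition img_submod n := submod_of_Prop (@img0 n) (@imgL n).

Lemma img_d i j (h : j + 1 = i) y : y \in img_submod i -> ch_d Y h y \in img_submod j.
Proof.
by move=> /asboolP[x <-]; apply/asboolP; exists (ch_d X h x); rewrite ch_funP.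
Qed.

Definition coker : chcomplex R := quotcx img_d.

Definition coker_pi : chmap Y coker := quotcx_pi img_d.

Lemma coker_exact : exact_chmap f coker_pi.
Proof. by move=> n y; split=> [/quotcx_pi_eq0/asboolP|fy]; last exact/quotcx_pi_eq0/asboolP. Qed.

Context (Z : chcomplex R) (g : chmap Y Z).
Hypothesis gf0 : comp_is0 g f.

Lemma coker_lift_subproof n y : y \in img_submod n -> g n y = 0.
Proof. by move=> /asboolP[x <-]. Qed.

Definition coker_lift : chmap coker Z := quotcx_lift img_d coker_lift_subproof.

Lemma coker_liftE n y : coker_lift n (coker_pi n y) = g n y.
Proof. exact: quotcx_liftE. Qed.

End Cokernel.

Section Kernel.
Context (R : pzRingType) (X Y : chcomplex R) (f : chmap X Y).

Lemma ker0 n : f n 0 = 0. Proof. exact: raddf0. Qed.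

Lemma kerL n (a : R) (x y : X n) : f n x = 0 -> f n y = 0 -> f n (a *: x + y) = 0.
Proof. by rewrite linearP => -> ->; rewrite scaler0 addr0. Qed.

Definition ker_submod n := submod_of_Prop (@ker0 n) (@kerL n).

Lemma ker_d i j (h : j + 1 = i) x : x \in ker_submod i -> ch_d X h x \in ker_submod j.
Proof. by move=> /asboolP fx; apply/asboolP; rewrite ch_funP fx raddf0. Qed.

End Kernel.

Section Lifting.
Context (R : pzRingType) (P A B C : chcomplex R).
Context (d : chmap A B) (d' : chmap B C) (f : chmap P B).

(** Exactness makes [d] a surjection onto the subcomplex of the kernel of [d'], and [f] factors
    through that subcomplex. *)
Lemma projective_lift :
  projective_cx P -> exact_chmap d d' -> comp_is0 d' f ->
  exists h : chmap P A, comp_is d h f.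
Proof.
move=> Pproj dd' f0.
have dK n a : d n a \in ker_submod d' n by apply/asboolP/dd'; exists a.
have fK n x : f n x \in ker_submod d' n by apply/asboolP/f0.
have [|h hP] := Pproj _ _ (subcx_lift (ker_d (f := d')) dK)
  (subcx_lift (ker_d (f := d')) fK).
  move=> n [y yK]; have /asboolP/dd'[a ay] := yK.
  by exists a; apply: val_inj; rewrite /= ay.
by exists h => n x; move/(congr1 val): (hP n x).
Qed.

End Lifting.

(** * Products and direct sums of complexes *)

Section ProductComplex.
Context (R : pzRingType) (I : Type) (L : I -> chcomplex R).

Definition prodcx_d i j (h : j + 1 = i) :
    {linear prodmod (fun k => L k i) -> prodmod (fun k => L k j)} :=
  prodmod_tuple (fun k => ch_d (L k) h \o @prodmod_proj R I (fun k => L k i) k).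

Lemma prodcx_dd i j k (h : j + 1 = i) (h' : k + 1 = j) x :
  prodcx_d h' (prodcx_d h x) = 0.
Proof. by apply: functional_extensionality_dep => l; apply: ch_dd. Qed.

Definition prodcx : chcomplex R := ChComplex prodcx_dd.

Definition prodcx_proj k : chmap prodcx (L k) :=
  @ChMap R prodcx (L k) (fun n => @prodmod_proj R I (fun k => L k n) k)
    (fun _ _ _ _ => erefl).

Lemma prodcx_ext n (x y : prodcx n) :
  (forall k, prodcx_proj k n x = prodcx_proj k n y) -> x = y.
Proof. exact: functional_extensionality_dep. Qed.

Context (Y : chcomplex R) (f : forall k, chmap Y (L k)).

Lemma prodcx_lift_subproof i j (h : j + 1 = i) y :
  prodmod_tuple (fun k => f k j) (ch_d Y h y)
    = ch_d prodcx h (prodmod_tuple (fun k => f k i) y).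
Proof. by apply: prodcx_ext => k; apply: ch_funP. Qed.

Definition prodcx_lift : chmap Y prodcx :=
  @ChMap R Y prodcx (fun n => prodmod_tuple (fun k => f k n)) prodcx_lift_subproof.

Lemma prodcx_liftE k n y : prodcx_proj k n (prodcx_lift n y) = f k n y.
Proof. by []. Qed.

End ProductComplex.

Section DirectSumComplex.
Context (R : pzRingType) (I : choiceType) (L : I -> chcomplex R).

Definition sumcx_d i j (h : j + 1 = i) :
    {linear dsummod (fun k => L k i) -> dsummod (fun k => L k j)} :=
  @dsummod_lift R I (fun k => L k i) (dsummod (fun k => L k j))
    (fun k => @dsummod_linj R I (fun k => L k j) k \o ch_d (L k) h).

Lemma sumcx_dE i j (h : j + 1 = i) k x :
  sumcx_d h (@dsummod_linj R I (fun k => L k i) k x)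
    = @dsummod_linj R I (fun k => L k j) k (ch_d (L k) h x).
Proof. exact: dsummod_liftE. Qed.

Lemma dsummod_ext (M : I -> lmodType R) (N : lmodType R)
    (f g : {linear dsummod M -> N}) :
  (forall i x, f (dsummod_linj M i x) = g (dsummod_linj M i x)) -> f =1 g.
Proof.
move=> fg; apply: dsummod_ind; first by rewrite !linear0.
  by move=> u v fgu fgv; rewrite !linearB fgu fgv.
exact: fg.
Qed.

Lemma sumcx_dd i j k (h : j + 1 = i) (h' : k + 1 = j) x :
  sumcx_d h' (sumcx_d h x) = 0.
Proof.
rewrite -[0]/((\0 : {linear dsummod _ -> dsummod _}) x).
rewrite -[LHS]/((sumcx_d h' \o sumcx_d h) x); apply: dsummod_ext => l y.
by rewrite /= !sumcx_dE ch_dd raddf0.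
Qed.

Definition sumcx : chcomplex R := ChComplex sumcx_dd.

Lemma sumcx_inj_subproof k i j (h : j + 1 = i) x :
  @dsummod_linj R I (fun k => L k j) k (ch_d (L k) h x)
    = ch_d sumcx h (@dsummod_linj R I (fun k => L k i) k x).
Proof. by rewrite /= sumcx_dE. Qed.

Definition sumcx_inj k : chmap (L k) sumcx :=
  @ChMap R (L k) sumcx (fun n => @dsummod_linj R I (fun k => L k n) k)
    (@sumcx_inj_subproof k).

Lemma sumcx_ext (Y : chcomplex R) (f g : chmap sumcx Y) :
  (forall k n x, f n (sumcx_inj k n x) = g n (sumcx_inj k n x)) -> eq_chmap f g.
Proof. by move=> fg n; apply: dsummod_ext => k x; apply: fg. Qed.

Context (Y : chcomplex R) (f : forall k, chmap (L k) Y).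

Lemma sumcx_lift_subproof i j (h : j + 1 = i) x :
  dsummod_lift (fun k => f k j) (ch_d sumcx h x)
    = ch_d Y h (dsummod_lift (fun k => f k i) x).
Proof.
rewrite -[LHS]/((dsummod_lift (fun k => f k j) \o ch_d sumcx h) x).
rewrite -[RHS]/((ch_d Y h \o dsummod_lift (fun k => f k i)) x).
by apply: dsummod_ext => k y; rewrite /= sumcx_dE !dsummod_liftE ch_funP.
Qed.

Definition sumcx_lift : chmap sumcx Y :=
  @ChMap R sumcx Y (fun n => dsummod_lift (fun k => f k n)) sumcx_lift_subproof.

Lemma sumcx_liftE k n x : sumcx_lift n (sumcx_inj k n x) = f k n x.
Proof. exact: dsummod_liftE. Qed.

End DirectSumComplex.

Lemma sumcx_is_coproduct (R : pzRingType) (I : choiceType) (L : I -> chcomplex R) :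
  is_coproduct (sumcx_inj L).
Proof.
move=> T t; exists (sumcx_lift t); split=> [i n x|v vt]; first exact: sumcx_liftE.
by apply: sumcx_ext => k n x; rewrite sumcx_liftE vt.
Qed.

Section Kronecker.
Context (R : pzRingType) (I : eqType) (L : I -> chcomplex R).

(** The cast along [i = j] is confined to this morphism. For fixed [i] the family gives the
    injection into a finite product, for fixed [j] the projection from a coproduct. *)
Definition kron i j : chmap (L i) (L j) :=
  match i =P j with
  | ReflectT e => match e in _ = k return chmap (L i) (L k) with erefl => ch_id (L i) end
  | ReflectF _ => ch_zero (L i) (L j)
  end.

Lemma kron_id i n x : kron i i n x = x.
Proof. by rewrite /kron; case: eqP => // e; rewrite (eq_irrelevance e erefl). Qed.

Lemma kron_neq i j n x : i <> j -> kron i j n x = 0.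
Proof. by rewrite /kron; case: eqP. Qed.

End Kronecker.

Section FiniteProduct.
Context (R : pzRingType) (T : finType) (L : T -> chcomplex R).

Definition prodcx_inj t : chmap (L t) (prodcx L) := prodcx_lift (kron L t).

Lemma prodcx_sum n (x : prodcx L n) :
  x = \sum_t prodcx_inj t n (prodcx_proj L t n x).
Proof.
apply: prodcx_ext => u; rewrite raddf_sum (bigD1 u) //= big1 ?addr0 => [|t /eqP tu].
  by rewrite -[LHS](@kron_id R T L u n).
exact: (kron_neq (L := L)).
Qed.

Lemma prodcx_sum_inj (Y : chcomplex R) (f : forall t, chmap (L t) Y) t n x :
  ch_sum (fun u => ch_comp (f u) (prodcx_proj L u)) n (prodcx_inj t n x) = f t n x.
Proof.
rewrite /= (bigD1 t) //= big1 => [|u /eqP ut]; last first.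
  rewrite -[RHS](linear0 (f u n)); congr (f u n _).
  by apply: (kron_neq (L := L)) => /esym.
by rewrite addr0; congr (f t n _); apply: (kron_id (L := L)).
Qed.

(** A map out of a finite product is the sum of its restrictions to the factors, so lifts found
    factor by factor add up. *)
Lemma prodcx_projective : (forall t, projective_cx (L t)) -> projective_cx (prodcx L).
Proof.
move=> Lproj Y Z g f gsurj.
have [h hP] := dep_choice (fun t => Lproj t Y Z g (ch_comp f (prodcx_inj t)) gsurj).
exists (ch_sum (fun t => ch_comp (h t) (prodcx_proj L t))) => n x.
rewrite [x in RHS]prodcx_sum /= !raddf_sum; apply: eq_bigr => t _.
exact: hP.
Qed.

End FiniteProduct.

Lemma fingen_finType (R : pzRingType) (M : lmodType R) (T : finType) (e : T -> M) :
  (forall x, exists c : T -> R, x = \sum_t c t *: e t) -> fingen_module M.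
Proof.
move=> gen; exists #|T|, (fun i => e (enum_val i)) => x.
have [c ->] := gen x; exists (fun i => c (enum_val i)).
by rewrite (reindex (@enum_val _ T)) //=; apply/onW_bij/enum_val_bij.
Qed.

Lemma prodcx_fingen (R : pzRingType) (T : finType) (L : T -> chcomplex R) :
  (forall t, fingen_cx (L t)) -> fingen_cx (prodcx L).
Proof.
move=> Lfg; split=> [|n].
  have [N NP] := dep_choice (fun t => (Lfg t).1).
  exists (\max_t N t)%N => n nN x; apply: prodcx_ext => t.
  rewrite raddf0; apply: NP; apply: leq_ltn_trans nN.
  exact: leq_bigmax.
have [K KP] := dep_choice (fun t => (Lfg t).2 n).
have [e eP] := dep_choice KP.
apply: (@fingen_finType R _ {t & 'I_(K t)} (fun u => prodcx_inj L (tag u) n (e _ (tagged u)))).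
move=> x; have [c cP] := dep_choice (fun t => eP t (prodcx_proj L t n x)).
exists (fun u => c (tag u) (tagged u)).
rewrite -(@sig_big_dep _ _ _ _ _ xpredT (fun _ => xpredT)
  (fun t k => c t k *: prodcx_inj L t n (e t k))).
rewrite [LHS]prodcx_sum; apply: eq_bigr => t _.
by rewrite [in LHS]cP linear_sum; apply: eq_bigr => k _; rewrite linearZ.
Qed.

(** * Disks, which represent the functors $Y \mapsto Y_q$ *)

Section Disk.
Context (R : pzRingType) (q : int).

(** The disk [D^q(R)], with [R] in degrees [q] and [q - 1] and the identity as
    differential. In every degree it is cut out of [R * R], the first factor
    standing for degree [q] and the second one for degree [q - 1]. *)
Definition disk_supp n (x : R^o * R^o) :=
  (n <> q -> x.1 = 0) /\ (n + 1 <> q -> x.2 = 0).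

Lemma disk_supp0 n : disk_supp n 0.
Proof. by []. Qed.

Lemma disk_suppL n a x y : disk_supp n x -> disk_supp n y -> disk_supp n (a *: x + y).
Proof.
move=> [x1 x2] [y1 y2]; split=> h /=.
  by rewrite x1 // y1 // scaler0 addr0.
by rewrite x2 // y2 // scaler0 addr0.
Qed.

Definition disk_ob n : lmodType R :=
  submodule (submod_of_Prop (@disk_supp0 n) (@disk_suppL n)).

Lemma disk_obP n (x : disk_ob n) : disk_supp n (val x).
Proof. exact/asboolP/(valP x). Qed.

Lemma disk_d_subproof i j (h : j + 1 = i) (x : disk_ob i) :
  (0, (val x).1) \in submod_of_Prop (@disk_supp0 j) (@disk_suppL j).
Proof. by apply/asboolP; split=> //=; rewrite h; case: (disk_obP x). Qed.

Definition disk_d_fun i j (h : j + 1 = i) (x : disk_ob i) : disk_ob j :=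
  Submodule (disk_d_subproof h x).

Lemma disk_d_linear i j (h : j + 1 = i) : linear (disk_d_fun h).
Proof.
move=> a x y; apply: val_inj; rewrite linearP /=.
by congr (_, _) => /=; rewrite scaler0 addr0.
Qed.

Lemma disk_dd i j k (h : j + 1 = i) (h' : k + 1 = j) x :
  linear_of (disk_d_linear h') (linear_of (disk_d_linear h) x) = 0.
Proof. exact: val_inj. Qed.

Definition disk : chcomplex R := ChComplex disk_dd.

Lemma disk_gen_subproof : (1, 0) \in submod_of_Prop (@disk_supp0 q) (@disk_suppL q).
Proof. exact/asboolP. Qed.

Definition disk_gen : disk q := Submodule disk_gen_subproof.

Definition disk_fst n (x : disk n) : R := (val x).1.
Definition disk_snd n (x : disk n) : R := (val x).2.

Lemma disk_fstL n a (x y : disk n) : disk_fst (a *: x + y) = a * disk_fst x + disk_fst y.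
Proof. by []. Qed.

Lemma disk_sndL n a (x y : disk n) : disk_snd (a *: x + y) = a * disk_snd x + disk_snd y.
Proof. by []. Qed.

Lemma disk_fst_d i j (h : j + 1 = i) x : disk_fst (ch_d disk h x) = 0.
Proof. by []. Qed.

Lemma disk_snd_d i j (h : j + 1 = i) x : disk_snd (ch_d disk h x) = disk_fst x.
Proof. by []. Qed.

Lemma disk_fst_gen : disk_fst disk_gen = 1. Proof. by []. Qed.

Lemma disk_snd_gen : disk_snd disk_gen = 0. Proof. by []. Qed.

Lemma disk_fst_neq n (x : disk n) : n <> q -> disk_fst x = 0.
Proof. by case: (disk_obP x). Qed.

Lemma disk_snd_neq n (x : disk n) : n + 1 <> q -> disk_snd x = 0.
Proof. by case: (disk_obP x). Qed.

Lemma disk_eqP n (x y : disk n) :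
  disk_fst x = disk_fst y -> disk_snd x = disk_snd y -> x = y.
Proof.
by case: x y => [[a b] xP] [[c d] yP] ac bd; apply: val_inj; congr (_, _).
Qed.

(** Every element is a combination of the generator [e] and of [de]. Since [ch_tr] and [ch_dt]
    vanish when the degrees do not match, one formula serves all degrees, and linear maps can be
    computed from it without a case distinction. *)
Lemma disk_decomp n (x : disk n) :
  x = disk_fst x *: ch_tr disk q n disk_gen + disk_snd x *: ch_dt disk q n disk_gen.
Proof.
have [e|/eqP nq] := eqVneq q n.
  case: n / e x => x; rewrite ch_trE ch_dt_neq; last exact: int_addr1_neq.
  rewrite (disk_snd_neq x (@int_addr1_neq q)) scale0r; apply: disk_eqP.
    by rewrite disk_fstL disk_fst_gen mulr1 addr0.
  by rewrite disk_sndL disk_snd_gen mulr0 addr0 (disk_snd_neq x (@int_addr1_neq q)).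
have fx : disk_fst x = 0 by apply: disk_fst_neq => /esym.
have [e|/eqP nq'] := eqVneq (n + 1) q.
  rewrite fx scale0r (ch_dtE e) addrC; apply: disk_eqP.
    by rewrite disk_fstL disk_fst_d mulr0 addr0.
  by rewrite disk_sndL disk_snd_d disk_fst_gen mulr1 addr0.
rewrite fx (disk_snd_neq x nq') !scale0r addr0; apply: disk_eqP => //.
exact: disk_snd_neq.
Qed.

Lemma disk_ext (Y : chcomplex R) (f g : chmap disk Y) :
  f q disk_gen = g q disk_gen -> eq_chmap f g.
Proof.
by move=> fg n x; rewrite (disk_decomp x) !linearP !linearZ /= !ch_fun_tr !ch_fun_dt fg.
Qed.

Section Map.
Context (Y : chcomplex R) (y : Y q).

Lemma disk_map_linear n :
  linear (fun x : disk n => disk_fst x *: ch_tr Y q n y + disk_snd x *: ch_dt Y q n y).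
Proof.
by move=> a u v; rewrite disk_fstL disk_sndL !scalerDl -!scalerA addrACA -scalerDr.
Qed.

Lemma disk_map_subproof i j (h : j + 1 = i) (x : disk i) :
  disk_fst (ch_d disk h x) *: ch_tr Y q j y + disk_snd (ch_d disk h x) *: ch_dt Y q j y
    = ch_d Y h (disk_fst x *: ch_tr Y q i y + disk_snd x *: ch_dt Y q i y).
Proof.
rewrite disk_fst_d disk_snd_d scale0r add0r linearP linearZ /=.
by rewrite ch_d_tr ch_d_dt scaler0 addr0.
Qed.

Definition disk_map : chmap disk Y := chmap_of disk_map_linear disk_map_subproof.

Lemma disk_map_gen : disk_map q disk_gen = y.
Proof. by rewrite /= disk_fst_gen disk_snd_gen scale1r scale0r addr0 ch_trE. Qed.

End Map.

Lemma disk_projective : projective_cx disk.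
Proof.
move=> Y Z g f gsurj; have [y gy] := gsurj q (f q disk_gen).
exists (disk_map y); apply: (disk_ext (f := ch_comp g (disk_map y)) (g := f)).
by rewrite -gy -[in RHS](disk_map_gen y).
Qed.

Lemma disk_fingen : fingen_cx disk.
Proof.
split=> [|n].
  (* The bound has to leave room for degree [q - 1], whose absolute value may exceed that of [q] by
     one. *)
  exists `|q|.+1%N => n nq x; rewrite [x]disk_decomp.
  by rewrite disk_fst_neq ?disk_snd_neq ?scale0r ?addr0 //; lia.
apply: (@fingen_finType R _ bool
  (fun b => if b then ch_tr disk q n disk_gen else ch_dt disk q n disk_gen)) => x.
exists (fun b => if b then disk_fst x else disk_snd x).
by rewrite big_bool; exact: disk_decomp.
Qed.

End Disk.

(** * The modified tensor product *)

Section TensbarElements.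
Context (R : pzRingType) (X : chcomplex R^c) (Y : chcomplex R).
Implicit Types (m i j : int).

(** The class of [x (x) y] in the modified tensor product. *)
Definition tb m i j (h : i + j = m) (x : X i) (y : Y j) : tensbar X Y m :=
  qpi (boundaries (tens_cx X Y) m) (tens_el h x y).

Lemma tb_balanced m i j (h : i + j = m) : balanced (tb h).
Proof.
have [eBl eBr eZ] := tens_el_balanced X Y h.
by split=> *; rewrite /tb ?eBl ?eBr ?eZ ?raddfB.
Qed.

Lemma tb0r m i j (h : i + j = m) x : tb h x 0 = 0.
Proof. by rewrite /tb tens_el0r raddf0. Qed.

Lemma tb0l m i j (h : i + j = m) y : tb h 0 y = 0.
Proof. by rewrite /tb tens_el0l raddf0. Qed.

Lemma tbDl m i j (h : i + j = m) x x' y : tb h (x + x') y = tb h x y + tb h x' y.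
Proof.
have [eB _ _] := tb_balanced h.
by rewrite -[x' in LHS]opprK eB -[- x']sub0r eB tb0l sub0r opprK.
Qed.

Lemma tbDr m i j (h : i + j = m) x y y' : tb h x (y + y') = tb h x y + tb h x y'.
Proof.
have [_ eB _] := tb_balanced h.
by rewrite -[y' in LHS]opprK eB -[- y']sub0r eB tb0r sub0r opprK.
Qed.

Lemma tb_zmod_morphism_r m i j (h : i + j = m) x : zmod_morphism (tb h x).
Proof. by have [_ eB _] := tb_balanced h; move=> y y'; apply: eB. Qed.

(** The boundary of [x (x) y] dies in the quotient. These are the only relations added to those of
    the ordinary tensor product, so [tensbar_lift] asks for exactly this identity. *)
Lemma tb_d m i j (h : i + j = m + 1) i' (hi : i' + 1 = i) j' (hj : j' + 1 = j)
    (hl : i' + j = m) (hr : i + j' = m) x y :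
  tb hl (ch_d X hi x) y + tb hr x (ch_d Y hj y) *~ (-1) ^+ `|i|%N = 0.
Proof.
apply/eqP; rewrite /tb -raddfMz -raddfD qpi_eq0; apply/asboolP.
by exists (tens_el h x y); apply: tens_dE.
Qed.

Lemma tensbar_ind m (P : tensbar X Y m -> Prop) :
  P 0 -> (forall a b, P a -> P b -> P (a - b)) ->
  (forall i j (h : i + j = m) x y, P (tb h x y)) -> forall z, P z.
Proof.
move=> P0 PB Pt z; have [w <-] := qpi_surj z.
elim/tens_ob_ind: w => [|a b Pa Pb|i j h x y]; first by rewrite raddf0.
  by rewrite raddfB; apply: PB.
exact: Pt.
Qed.

Lemma tensbar_ext m (B : zmodType) (f g : {additive tensbar X Y m -> B}) :
  (forall i j (h : i + j = m) x y, f (tb h x y) = g (tb h x y)) -> f =1 g.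
Proof.
move=> fg; apply: tensbar_ind => // [|a b fga fgb]; first by rewrite !raddf0.
by rewrite !raddfB fga fgb.
Qed.

Section Lift.
Context (m : int) (B : zmodType).
Context (f : forall i j, i + j = m -> X i -> Y j -> B).
Hypothesis fP : forall i j (h : i + j = m), balanced (f h).
Hypothesis fd : forall i j (h : i + j = m + 1) i' (hi : i' + 1 = i)
  j' (hj : j' + 1 = j) (hl : i' + j = m) (hr : i + j' = m) x y,
  f hl (ch_d X hi x) y + f hr x (ch_d Y hj y) *~ (-1) ^+ `|i|%N = 0.

Lemma tensbar_lift_subproof z :
  z \in boundaries (tens_cx X Y) m -> tens_ob_lift fP z = 0.
Proof.
case/asboolP => w <- /=.
elim/tens_ob_ind: w => [|a b a0 b0|i j h x y]; first by rewrite !raddf0.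
  by rewrite !raddfB a0 b0 subrr.
have hl := predl_subproof (erefl (m + 1)) h.
have hr := predr_subproof (erefl (m + 1)) h.
rewrite (tens_dE _ h (subrK 1 i) (subrK 1 j) hl hr) raddfD raddfMz /=.
by rewrite !tens_ob_liftE fd.
Qed.

Definition tensbar_lift : {additive tensbar X Y m -> B} :=
  qlift tensbar_lift_subproof.

Lemma tensbar_liftE i j (h : i + j = m) x y : tensbar_lift (tb h x y) = f h x y.
Proof. by rewrite /tensbar_lift /tb qliftE tens_ob_liftE. Qed.

End Lift.

End TensbarElements.

Section TensbarMaps.
Context (R : pzRingType).

(** Unbundled versions of [tensbar_map] and of its analogue in the second
    variable: rewriting through the bundled morphisms is very slow. *)
Definition tmap (X X' : chcomplex R^c) (f : chmap X X') (Y : chcomplex R) m :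
    tensbar X Y m -> tensbar X' Y m :=
  tensbar_map f Y m.

Lemma tmapE (X X' : chcomplex R^c) (f : chmap X X') (Y : chcomplex R)
    m i j (h : i + j = m) x (y : Y j) :
  tmap f (tb h x y) = tb h (f i x) y.
Proof. by rewrite /tmap /tensbar_map /tb qliftE /= tens_mapE. Qed.

Section Right.
Context (X : chcomplex R^c) (Y Y' : chcomplex R) (g : chmap Y Y') (m : int).

Definition tmapr_fun i j (h : i + j = m) (x : X i) (y : Y j) :
  tensbar X Y' m := tb h x (g j y).

Lemma tmapr_balanced i j (h : i + j = m) : balanced (tmapr_fun h).
Proof.
have [eBl eBr eZ] := tb_balanced X Y' h.
by split=> *; rewrite /tmapr_fun ?linearB ?linearZ ?eBl ?eBr ?eZ.
Qed.

Lemma tmapr_d i j (h : i + j = m + 1) i' (hi : i' + 1 = i)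
    j' (hj : j' + 1 = j) (hl : i' + j = m) (hr : i + j' = m) x y :
  tmapr_fun hl (ch_d X hi x) y
    + tmapr_fun hr x (ch_d Y hj y) *~ (-1) ^+ `|i|%N = 0.
Proof. by rewrite /tmapr_fun ch_funP tb_d. Qed.

Definition tmapr_add : {additive tensbar X Y m -> tensbar X Y' m} :=
  tensbar_lift tmapr_balanced tmapr_d.

Definition tmapr : tensbar X Y m -> tensbar X Y' m := tmapr_add.

Lemma tmaprE i j (h : i + j = m) x y : tmapr (tb h x y) = tb h x (g j y).
Proof. exact: tensbar_liftE. Qed.

Lemma tmaprB t u : tmapr (t - u) = tmapr t - tmapr u.
Proof. exact: (raddfB tmapr_add). Qed.

Lemma tmapr_zero : tmapr 0 = 0.
Proof. exact: (raddf0 tmapr_add). Qed.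

Lemma tmapr_sum (T : Type) (r : seq T) (F : T -> tensbar X Y m) :
  tmapr (\sum_(k <- r) F k) = \sum_(k <- r) tmapr (F k).
Proof. exact: (raddf_sum tmapr_add). Qed.

End Right.

Arguments tmapr X [Y Y'] g [m].

Implicit Types (X : chcomplex R^c) (Y : chcomplex R).

Section Left.
Context X X' (f : chmap X X') Y (m : int).

Lemma tmapB (t u : tensbar X Y m) : tmap f (t - u) = tmap f t - tmap f u.
Proof. exact: (raddfB (tensbar_map f Y m)). Qed.

Lemma tmap_zero : tmap f 0 = 0 :> tensbar X' Y m.
Proof. exact: (raddf0 (tensbar_map f Y m)). Qed.

Lemma tmapD (t u : tensbar X Y m) : tmap f (t + u) = tmap f t + tmap f u.
Proof. exact: (raddfD (tensbar_map f Y m)). Qed.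

Lemma tmap_sum (T : Type) (r : seq T) (F : T -> tensbar X Y m) :
  tmap f (\sum_(k <- r) F k) = \sum_(k <- r) tmap f (F k).
Proof. exact: (raddf_sum (tensbar_map f Y m)). Qed.

End Left.

Lemma tmap_tmapr X X' Y Y' (f : chmap X X') (g : chmap Y Y') m (t : tensbar X Y m) :
  tmap f (tmapr X g t) = tmapr X' g (tmap f t).
Proof.
move: t; apply: (tensbar_ext
  (f := tensbar_map f Y' m \o tmapr_add X g m)
  (g := tmapr_add X' g m \o tensbar_map f Y m)) => i j h x y.
change (tmap f (tmapr X g (tb h x y)) = tmapr X' g (tmap f (tb h x y))).
by rewrite tmaprE !tmapE tmaprE.
Qed.

Lemma tmap_comp X X' X'' Y (f : chmap X X') (g : chmap X' X'') m (t : tensbar X Y m) :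
  tmap (ch_comp g f) t = tmap g (tmap f t).
Proof.
move: t; apply: (tensbar_ext (f := tensbar_map (ch_comp g f) Y m)
  (g := tensbar_map g Y m \o tensbar_map f Y m)) => i j h x y.
change (tmap (ch_comp g f) (tb h x y) = tmap g (tmap f (tb h x y))).
by rewrite !tmapE.
Qed.

Lemma tmap_eq X X' Y (f g : chmap X X') :
  eq_chmap f g -> forall m (t : tensbar X Y m), tmap f t = tmap g t.
Proof.
move=> fg m; apply: (tensbar_ext (f := tensbar_map f Y m)
  (g := tensbar_map g Y m)) => i j h x y.
change (tmap f (tb h x y) = tmap g (tb h x y)).
by rewrite !tmapE fg.
Qed.

Lemma tmap0 X X' Y (f : chmap X X') :
  (forall n x, f n x = 0) -> forall m (t : tensbar X Y m), tmap f t = 0.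
Proof.
move=> f0 m; apply: (tensbar_ext (f := tensbar_map f Y m) (g := \0)) => i j h x y.
by change (tmap f (tb h x y) = 0); rewrite tmapE f0 tb0l.
Qed.

Lemma tmap_add X X' Y (f f1 f2 : chmap X X') :
  (forall n x, f n x = f1 n x + f2 n x) -> forall m (t : tensbar X Y m),
  tmap f t = tmap f1 t + tmap f2 t.
Proof.
move=> fD m; apply: (tensbar_ext (f := tensbar_map f Y m)
  (g := tensbar_map f1 Y m \+ tensbar_map f2 Y m)) => i j h x y.
change (tmap f (tb h x y) = tmap f1 (tb h x y) + tmap f2 (tb h x y)).
by rewrite !tmapE fD tbDl.
Qed.

Lemma tmap_ch_sum X X' Y (T : finType) (f : T -> chmap X X') m (t : tensbar X Y m) :
  tmap (ch_sum f) t = \sum_k tmap (f k) t.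
Proof.
elim/tensbar_ind: t => [|a b ha hb|i j h x y].
- by rewrite tmap_zero big1 // => k _; rewrite tmap_zero.
- by rewrite tmapB ha hb -sumrB; apply: eq_bigr => k _; rewrite tmapB.
rewrite tmapE (eq_bigr _ (fun k _ => tmapE (f k) h x y)) /=.
by elim/big_rec2: _ => [|k u v _ <-]; rewrite ?tb0l ?tbDl.
Qed.

Lemma tmap_id X Y (f : chmap X X) :
  (forall n x, f n x = x) -> forall m (t : tensbar X Y m), tmap f t = t.
Proof.
move=> fid m; apply: (tensbar_ext (f := tensbar_map f Y m) (g := idfun)) => i j h x y.
by change (tmap f (tb h x y) = tb h x y); rewrite tmapE fid.
Qed.

Lemma tmapr_comp X Y Y' Y'' (f : chmap Y Y') (g : chmap Y' Y'') (k : chmap Y Y'') :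
  comp_is g f k -> forall m (t : tensbar X Y m),
  tmapr X g (tmapr X f t) = tmapr X k t.
Proof.
move=> gf m; apply: (tensbar_ext
  (f := tmapr_add X g m \o tmapr_add X f m) (g := tmapr_add X k m)) => i j h x y.
change (tmapr X g (tmapr X f (tb h x y)) = tmapr X k (tb h x y)).
by rewrite !tmaprE gf.
Qed.

Lemma tmapr0 X Y Y' (f : chmap Y Y') :
  (forall n x, f n x = 0) -> forall m (t : tensbar X Y m), tmapr X f t = 0.
Proof.
move=> f0 m; apply: (tensbar_ext (f := tmapr_add X f m) (g := \0)) => i j h x y.
by change (tmapr X f (tb h x y) = 0); rewrite tmaprE f0 tb0r.
Qed.

Lemma tmapr_id X Y (f : chmap Y Y) :
  (forall n x, f n x = x) -> forall m (t : tensbar X Y m), tmapr X f t = t.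
Proof.
move=> fid m; apply: (tensbar_ext (f := tmapr_add X f m) (g := idfun)) => i j h x y.
by change (tmapr X f (tb h x y) = tb h x y); rewrite tmaprE fid.
Qed.

End TensbarMaps.

Arguments tmapr [R] X [Y Y'] g [m].

(** * The modified tensor product with a disk, on either side *)

Section DiskLeft.
Context (R : pzRingType) (q m : int) (Y : chcomplex R).
Local Notation D := (disk R^c q).

(** [(D^q(R) (x) Y)_m] is [Y_(m - q)]: modulo boundaries the generator [e] of
    degree [q] satisfies [de (x) y = - (-1)^q e (x) dy]. *)
Definition disk_coef_fun i j (h : i + j = m) (x : D i) (y : Y j) : Y (m - q) :=
  (disk_fst x : R) *: ch_tr Y j (m - q) y
    - ((disk_snd x : R) *: ch_dt Y j (m - q) y) *~ (-1) ^+ `|q|%N.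

Lemma disk_coef_balanced i j (h : i + j = m) : balanced (disk_coef_fun h).
Proof.
have fB (x x' : D i) : disk_fst (x - x') = disk_fst x - disk_fst x' by [].
have sB (x x' : D i) : disk_snd (x - x') = disk_snd x - disk_snd x' by [].
rewrite /disk_coef_fun; split=> [x x' y|x y y'|x a y].
- by rewrite fB sB !scalerBl mulrzBl !opprD addrACA.
- by rewrite !linearB /= !scalerBr mulrzBl !opprD addrACA.
by rewrite !linearZ /= !scalerA.
Qed.

Lemma disk_coef_d i j (h : i + j = m + 1) i' (hi : i' + 1 = i)
    j' (hj : j' + 1 = j) (hl : i' + j = m) (hr : i + j' = m) x y :
  disk_coef_fun hl (ch_d D hi x) y
    + disk_coef_fun hr x (ch_d Y hj y) *~ (-1) ^+ `|i|%N = 0.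
Proof.
rewrite /disk_coef_fun disk_fst_d disk_snd_d scale0r sub0r.
have [e|/eqP iq] := eqVneq i q; last first.
  rewrite disk_fst_neq // !scale0r mul0rz oppr0 add0r sub0r.
  rewrite (_ : ch_dt _ _ _ _ = 0) ?scaler0 ?mul0rz ?oppr0 ?mul0rz //.
  have [e|/eqP e] := eqVneq (m - q + 1) j'; last by rewrite ch_dt_neq.
  by rewrite (ch_dtE e) ch_dd.
have e' : j' = m - q by lia.
have sx : disk_snd x = 0 by apply: disk_snd_neq; lia.
have -> : `|q|%N = `|i|%N by rewrite e.
subst j'; rewrite sx scale0r mul0rz subr0.
by rewrite ch_trE (ch_dtE hj) addNr.
Qed.

Definition disk_coef : {additive tensbar D Y m -> Y (m - q)} :=
  tensbar_lift disk_coef_balanced disk_coef_d.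

Lemma disk_coefE i j (h : i + j = m) (x : D i) (y : Y j) :
  disk_coef (tb h x y) = disk_coef_fun h x y.
Proof. exact: tensbar_liftE. Qed.

Definition disk_tens (y : Y (m - q)) : tensbar D Y m :=
  tb (subrKC q m) (disk_gen R^c q) y.

Lemma disk_tens_zmod_morphism : zmod_morphism disk_tens.
Proof. exact: tb_zmod_morphism_r. Qed.

HB.instance Definition _ :=
  GRing.isZmodMorphism.Build (Y (m - q)) (tensbar D Y m) disk_tens
    disk_tens_zmod_morphism.

(** On [x (x) y] with [x] a multiple of [e] the scalar crosses the tensor sign; with [x] a multiple
    of [de] the boundary of [e (x) y] trades [de (x) y] for [e (x) dy]. *)
Lemma disk_tensK t : disk_tens (disk_coef t) = t.
Proof.
move: t; apply: (tensbar_ext (f := disk_tens \o disk_coef) (g := idfun)) => i j h x y.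
rewrite /= disk_coefE /disk_coef_fun raddfB raddfMz /= /disk_tens.
have [_ _ eZ] := tb_balanced D Y (subrKC q m).
rewrite -!eZ [x in RHS]disk_decomp tbDl.
have [e|/eqP iq] := eqVneq i q.
  have e' : j = m - q by lia.
  have sx : disk_snd x = 0 by apply: disk_snd_neq; lia.
  rewrite sx; subst i; subst j; rewrite !scale0r !tb0l.
  by rewrite mul0rz subr0 addr0 !ch_trE (eq_irrelevance h (subrKC q m)).
rewrite (disk_fst_neq x iq) !scale0r !tb0l sub0r add0r.
have [e|/eqP iq1] := eqVneq (i + 1) q; last first.
  by rewrite (disk_snd_neq x iq1) !scale0r !tb0l mul0rz oppr0.
have hj : m - q + 1 = j by lia.
rewrite (ch_dtE e) (ch_dtE hj).
have [_ _ eZ'] := tb_balanced D Y h.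
rewrite eZ eZ' -linearZ /=; apply/esym/eqP; rewrite -addr_eq0; apply/eqP.
by apply: (tb_d (m := m)); lia.
Qed.

End DiskLeft.

Lemma mulrz_signK (V : zmodType) (v : V) (n : nat) :
  v *~ (-1) ^+ n *~ (-1) ^+ n = v.
Proof. by rewrite -mulrzA -expr2 sqrr_sign. Qed.

Section DiskRight.
Context (R : pzRingType) (q m : int) (X : chcomplex R^c).
Local Notation D := (disk R q).

(** The mirror image of [disk_coef_fun]: modulo boundaries [x (x) de = - (-1)^i dx (x) e], where the
    sign now depends on the degree [i] of [x] instead of the fixed degree [q]. *)
Definition codisk_coef_fun i j (h : i + j = m) (x : X i) (y : D j) : X (m - q) :=
  (disk_fst y : R^c) *: ch_tr X i (m - q) x
    - ((disk_snd y : R^c) *: ch_dt X i (m - q) x) *~ (-1) ^+ `|i|%N.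

Lemma codisk_coef_balanced i j (h : i + j = m) : balanced (codisk_coef_fun h).
Proof.
have fB (y y' : D j) : disk_fst (y - y') = disk_fst y - disk_fst y' by [].
have sB (y y' : D j) : disk_snd (y - y') = disk_snd y - disk_snd y' by [].
rewrite /codisk_coef_fun; split=> [x x' y|x y y'|x a y].
- by rewrite !linearB /= !scalerBr mulrzBl !opprD addrACA.
- by rewrite fB sB !scalerBl mulrzBl !opprD addrACA.
by rewrite !linearZ /= !scalerA.
Qed.

Lemma codisk_coef_d i j (h : i + j = m + 1) i' (hi : i' + 1 = i)
    j' (hj : j' + 1 = j) (hl : i' + j = m) (hr : i + j' = m) x y :
  codisk_coef_fun hl (ch_d X hi x) y
    + codisk_coef_fun hr x (ch_d D hj y) *~ (-1) ^+ `|i|%N = 0.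
Proof.
rewrite /codisk_coef_fun disk_fst_d disk_snd_d scale0r sub0r mulNrz mulrz_signK.
rewrite (_ : ch_dt _ _ _ _ = 0) ?scaler0 ?mul0rz ?subr0; last first.
  have [e|/eqP e] := eqVneq (m - q + 1) i'; last by rewrite ch_dt_neq.
  by rewrite (ch_dtE e) ch_dd.
have [e|/eqP jq] := eqVneq j q; last by rewrite disk_fst_neq // !scale0r subrr.
have e' : i' = m - q by lia.
by subst i'; rewrite ch_trE (ch_dtE hi) subrr.
Qed.

Definition codisk_coef : {additive tensbar X D m -> X (m - q)} :=
  tensbar_lift codisk_coef_balanced codisk_coef_d.

Lemma codisk_coefE i j (h : i + j = m) (x : X i) (y : D j) :
  codisk_coef (tb h x y) = codisk_coef_fun h x y.
Proof. exact: tensbar_liftE. Qed.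

Definition codisk_tens (x : X (m - q)) : tensbar X D m :=
  tb (subrK q m) x (disk_gen R q).

Lemma codisk_tens_zmod_morphism : zmod_morphism codisk_tens.
Proof. by have [eB _ _] := tb_balanced X D (subrK q m); move=> x x'; apply: eB. Qed.

HB.instance Definition _ :=
  GRing.isZmodMorphism.Build (X (m - q)) (tensbar X D m) codisk_tens
    codisk_tens_zmod_morphism.

Lemma codisk_tensK t : codisk_tens (codisk_coef t) = t.
Proof.
move: t; apply: (tensbar_ext (f := codisk_tens \o codisk_coef) (g := idfun)) => i j h x y.
rewrite /= codisk_coefE /codisk_coef_fun raddfB raddfMz /= /codisk_tens.
have [_ _ eZ] := tb_balanced X D (subrK q m).
rewrite !eZ [y in RHS]disk_decomp tbDr.
have [e|/eqP jq] := eqVneq j q.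
  have e' : i = m - q by lia.
  have sy : disk_snd y = 0 by apply: disk_snd_neq; lia.
  rewrite sy; subst j; subst i; rewrite !scale0r !tb0r.
  by rewrite mul0rz subr0 addr0 !ch_trE (eq_irrelevance h (subrK q m)).
rewrite (disk_fst_neq y jq) !scale0r !tb0r sub0r add0r.
have [e|/eqP jq1] := eqVneq (j + 1) q; last first.
  by rewrite (disk_snd_neq y jq1) !scale0r !tb0r mul0rz oppr0.
have hi : m - q + 1 = i by lia.
rewrite (ch_dtE e) (ch_dtE hi).
have [_ _ eZ'] := tb_balanced X D h.
rewrite -eZ -eZ' -linearZ /=; apply/esym/eqP; rewrite -addr_eq0; apply/eqP.
set z := _ *: x; have hd : i + q = m + 1 by lia.
(* In the boundary of [z (x) e] the sign sits on the term to be solved for, so the relation is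
   multiplied by it once more. *)
have := congr1 (fun v => v *~ (-1) ^+ `|i|%N) (tb_d hd hi e (subrK q m) h z (disk_gen R q)).
by rewrite /= mulrzDl mulrz_signK mul0rz addrC.
Qed.

Lemma codisk_coefK x : codisk_coef (codisk_tens x) = x.
Proof.
rewrite codisk_coefE /codisk_coef_fun disk_fst_gen disk_snd_gen.
by rewrite scale0r mul0rz subr0 ch_trE scale1r.
Qed.

End DiskRight.

(** * Finitely generated projectives and coordinates *)

Section FinGenProjective.
Context (R : pzRingType) (P : chcomplex R).
Hypotheses (Pproj : projective_cx P) (Pfg : fingen_cx P).

(** The disks correspond to finitely many generators in each of the degrees $-N, \dots, N$ that
    carry the complex. Their product maps onto [P], and projectivity splits this surjection. *)
Lemma fingen_projective_retract : exists (T : finType) (q : T -> int)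
    (r : forall t, chmap P (disk R (q t))) (p : forall t, chmap (disk R (q t)) P),
  forall n x, \sum_t p t n (r t n x) = x.
Proof.
have [[N Nbound] Pgen] := Pfg.
have [K KP] := dep_choice Pgen; have [e eP] := dep_choice KP.
pose deg (i : 'I_(N + N).+1) : int := (i : nat)%:Z - N%:Z.
pose T : finType := {i : 'I_(N + N).+1 & 'I_(K (deg i))}.
pose q (t : T) := deg (tag t).
pose p (t : T) : chmap (disk R (q t)) P := disk_map (e _ (tagged t)).
pose F := prodcx (fun t => disk R (q t)).
pose g : chmap F P := ch_sum (fun t => ch_comp (p t) (prodcx_proj _ t)).
have g_inj t : g (q t) (prodcx_inj _ t (q t) (disk_gen R (q t))) = e _ (tagged t).
  by rewrite /g prodcx_sum_inj; apply: disk_map_gen.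
have gsurj : surjective_chmap g.
  move=> n y; have [nN|nN] := ltnP N `|n|.
    by exists 0; rewrite raddf0; apply/esym/(Nbound n nN).
  have [i en] : exists i : 'I_(N + N).+1, n = deg i.
    have h : (`|(n + N%:Z)%R| < (N + N).+1)%N by lia.
    by exists (Ordinal h); rewrite /deg /=; lia.
  subst n; have [c ->] := eP _ y.
  pose tg (k : 'I_(K (deg i))) : T := existT (fun j => 'I_(K (deg j))) i k.
  exists (\sum_k c k *: prodcx_inj (fun t => disk R (q t)) (tg k) (deg i) (disk_gen R (deg i))).
  rewrite linear_sum; apply: eq_bigr => k _; rewrite linearZ; congr (_ *: _).
  exact: (g_inj (tg k)).
have [s sP] := Pproj (ch_id P) gsurj.
exists T, q, (fun t => ch_comp (prodcx_proj _ t) s), p => n x.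
exact: sP.
Qed.

End FinGenProjective.

(** Natural coordinates on [(P (x) Y)_m]: they exhibit it as a direct summand of
    a finite product of terms of [Y], naturally in [Y]. *)
Record coordinates (R : pzRingType) (P : chcomplex R^c) (m : int) := Coordinates {
  co_idx : finType;
  co_deg : co_idx -> int;
  co_coef : forall (Y : chcomplex R) k, tensbar P Y m -> Y (co_deg k);
  co_tens : forall (Y : chcomplex R) k, Y (co_deg k) -> tensbar P Y m;
  co_coefB : forall Y k, zmod_morphism (@co_coef Y k);
  co_tensB : forall Y k, zmod_morphism (@co_tens Y k);
  co_coef_nat : forall Y Y' (g : chmap Y Y') k (t : tensbar P Y m),
    co_coef k (tmapr P g t) = g _ (co_coef k t);
  co_tens_nat : forall Y Y' (g : chmap Y Y') k (y : Y (co_deg k)),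
    tmapr P g (co_tens y) = co_tens (g _ y);
  co_decomp : forall Y (t : tensbar P Y m), \sum_k co_tens (co_coef k t) = t
}.

Section CoordinatesExist.
Context (R : pzRingType) (P : chcomplex R^c).

Lemma disk_coef_nat q m (Y Y' : chcomplex R) (g : chmap Y Y') t :
  disk_coef q m Y' (tmapr (disk R^c q) g t) = g _ (disk_coef q m Y t).
Proof.
move: t; apply: (tensbar_ext (f := disk_coef q m Y' \o tmapr_add (disk R^c q) g m)
  (g := g (m - q) \o disk_coef q m Y)) => i j h x y.
rewrite /= [tmapr_add _ _ _ _]tmaprE !disk_coefE /disk_coef_fun -ch_fun_tr -ch_fun_dt.
rewrite [RHS]linearB; congr (_ - _); first by rewrite linearZ.
by rewrite (raddfMz (g (m - q))); congr (_ *~ _); rewrite -[LHS]linearZ.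
Qed.

(** The identification of $(D^q(R) \overline{\otimes} Y)_m$ with $Y_{m-q}$ is carried along the
    retraction onto [P]. Only [inhabited] is claimed, because that retraction is merely known to
    exist. *)
Lemma coordinates_exist m :
  projective_cx P -> fingen_cx P -> inhabited (coordinates P m).
Proof.
move=> Pproj Pfg; have [T [q [r [p rp]]]] := fingen_projective_retract Pproj Pfg.
constructor; exists T (fun t => m - q t)
  (fun Y t u => disk_coef (q t) m Y (tmap (r t) u))
  (fun Y t y => tmap (p t) (@disk_tens R (q t) m Y y)).
- by move=> Y k t u; rewrite tmapB raddfB.
- by move=> Y k y z; rewrite (raddfB (@disk_tens R (q k) m Y)) tmapB.
- by move=> Y Y' g k t; rewrite tmap_tmapr disk_coef_nat.
- by move=> Y Y' g k y; rewrite -tmap_tmapr /disk_tens tmaprE.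
move=> Y t; under eq_bigr => k _ do rewrite disk_tensK -tmap_comp.
rewrite -tmap_ch_sum; exact: tmap_id.
Qed.

End CoordinatesExist.

(** * Independence of the resolution *)

Opaque tmap tmapr.

Section CoordinatesTheory.
Context (R : pzRingType) (P : chcomplex R^c) (m : int) (c : coordinates P m).
Context (Y : chcomplex R).

Lemma co_coef0 k : co_coef k (0 : tensbar P Y m) = 0 :> Y (co_deg (c := c) k).
Proof. by have := co_coefB (c := c) (Y := Y) k 0 0; rewrite !subrr. Qed.

Lemma co_coef_sum (T : Type) (r : seq T) (F : T -> tensbar P Y m) (k : co_idx c) :
  co_coef k (\sum_(i <- r) F i) = \sum_(i <- r) co_coef k (F i).
Proof.
elim: r => [|i r IHr]; first by rewrite !big_nil co_coef0.
rewrite !big_cons -IHr; move: (\sum_(j <- r) F j) => u.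
have uN : co_coef k (- u) = - co_coef k u by rewrite -[- u]sub0r co_coefB co_coef0 sub0r.
by rewrite -{1}[u]opprK co_coefB uN opprK.
Qed.

Lemma co_tens0 k : co_tens (0 : Y (co_deg (c := c) k)) = 0.
Proof. by have := co_tensB (c := c) (Y := Y) (k := k) 0 0; rewrite !subrr. Qed.

Lemma co_eq0 (t : tensbar P Y m) :
  (forall k : co_idx c, co_coef k t = 0) -> t = 0.
Proof.
move=> t0; rewrite -[t](co_decomp c) big1 // => k _.
by rewrite t0 co_tens0.
Qed.

End CoordinatesTheory.

(** * Exactness of tensoring with a finitely generated projective complex *)

Section TensbarExact.
Context (R : pzRingType) (P : chcomplex R^c).
Hypotheses (Pproj : projective_cx P) (Pfg : fingen_cx P).
Implicit Types (Y Z : chcomplex R).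

Lemma tmapr_inj Y Z (g : chmap Y Z) m (t : tensbar P Y m) :
  injective_chmap g -> tmapr P g t = 0 -> t = 0.
Proof.
have [c] := coordinates_exist m Pproj Pfg.
move=> ginj gt; apply: (co_eq0 (c := c)) => k; apply: ginj.
by rewrite raddf0 -co_coef_nat gt co_coef0.
Qed.

(** By naturality the coordinates of [t] are killed by [g]; their preimages under [f] are
    reassembled by [co_tens]. *)
Lemma tmapr_exact X Y Z (f : chmap X Y) (g : chmap Y Z) m (t : tensbar P Y m) :
  exact_chmap f g -> tmapr P g t = 0 -> exists u, tmapr P f u = t.
Proof.
have [c] := coordinates_exist m Pproj Pfg.
move=> fg gt.
have xP (k : co_idx c) : exists x, f _ x = co_coef k t.
  by apply/fg; rewrite -co_coef_nat gt co_coef0.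
have [x fx] := dep_choice xP; exists (\sum_k co_tens (x k)).
rewrite tmapr_sum -[RHS](co_decomp c); apply: eq_bigr => k _.
by rewrite co_tens_nat fx.
Qed.

Lemma tmapr_surj Y Z (g : chmap Y Z) m (t : tensbar P Z m) :
  surjective_chmap g -> exists u, tmapr P g u = t.
Proof.
have [c] := coordinates_exist m Pproj Pfg.
move=> gsurj; have [y gy] := dep_choice (fun k : co_idx c => gsurj _ (co_coef k t)).
exists (\sum_k co_tens (y k)).
rewrite tmapr_sum -[RHS](co_decomp c); apply: eq_bigr => k _.
by rewrite co_tens_nat gy.
Qed.

End TensbarExact.

(** One inclusion suffices to express that [homology f g] vanishes, since [homology] divides the
    kernel by the part of it that lies in the image. *)
Definition mid_exact (A B C : zmodType) (f : A -> B) (g : B -> C) :=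
  forall y, g y = 0 -> exists x, f x = y.

Lemma homology_eq0 (A B C : zmodType) (f : {additive A -> B}) (g : {additive B -> C}) :
  (forall t : homology f g, t = 0) <-> mid_exact f g.
Proof.
split=> [H0 y gy|fg t].
  have yK : y \in ker_pred g by apply/eqP.
  have /eqP := H0 (qpi (@bound_pred A B C f g : zmodClosed (kernel g)) (Kernel yK)).
  by rewrite qpi_eq0 => /asboolP.
have [[y yK] <-] := qpi_surj t.
by apply/eqP; rewrite qpi_eq0; apply/asboolP; apply: fg; apply/eqP.
Qed.

Lemma torbar_vanishesE (R : pzRingType) n (X : chcomplex R^c) (L : chcomplex R) :
  torbar_vanishes n.+1 X L <->
  forall (P : proj_resolution X) m,
    mid_exact (@tmap _ _ _ (res_d P n.+1) L m) (@tmap _ _ _ (res_d P n) L m).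
Proof.
split=> [H P m|H P m]; first by apply/homology_eq0 => t; apply: (H P m).
exact/homology_eq0.
Qed.

Lemma exact_comp0 (R : pzRingType) (X Y Z : chcomplex R) (f : chmap X Y) (g : chmap Y Z) :
  exact_chmap f g -> comp_is0 g f.
Proof. by move=> fg n x; apply/fg; exists x. Qed.

(** * Comparison of two projective resolutions *)

Section Comparison.
Context (R : pzRingType) (X : chcomplex R) (P Q : proj_resolution X).

Lemma res_lift (F : chcomplex R) (S : proj_resolution X) n (f : chmap F (S n.+1)) :
  projective_cx F -> comp_is0 (res_d S n) f ->
  exists h : chmap F (S n.+2), comp_is (res_d S n.+1) h f.
Proof. by move=> Fproj f0; apply: projective_lift f0 => //; apply: res_exact. Qed.

(** The comparison theorem in a window: instead of whole chain maps and a homotopy, the induction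
    carries only the components around degree [n + 1]. Each step adds one component of each kind and
    forgets the lowest one. *)
Lemma res_comparison n : exists
  (f0 : chmap (P n) (Q n)) (f1 : chmap (P n.+1) (Q n.+1))
  (g0 : chmap (Q n) (P n)) (g1 : chmap (Q n.+1) (P n.+1)) (g2 : chmap (Q n.+2) (P n.+2))
  (h0 : chmap (P n) (P n.+1)) (h1 : chmap (P n.+1) (P n.+2)),
  [/\ forall k x, res_d Q n k (f1 k x) = f0 k (res_d P n k x),
      forall k x, res_d P n k (g1 k x) = g0 k (res_d Q n k x),
      forall k x, res_d P n.+1 k (g2 k x) = g1 k (res_d Q n.+1 k x)
    & forall k x, g1 k (f1 k x) - x = res_d P n.+1 k (h1 k x) + h0 k (res_d P n k x)].
Proof.
have dd (S : proj_resolution X) i : comp_is0 (res_d S i) (res_d S i.+1).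
  exact/exact_comp0/res_exact.
have dd0 (S : proj_resolution X) : comp_is0 (res_aug S) (res_d S 0).
  exact/exact_comp0/res_exact0.
elim: n => [|n [f0 [f1 [g0 [g1 [g2 [h0 [h1 [df dg dg' gf]]]]]]]]].
  have [f0 f0P] := @res_proj _ _ P 0 _ _ _ (res_aug P) (@res_aug_surj _ _ Q).
  have [g0 g0P] := @res_proj _ _ Q 0 _ _ _ (res_aug Q) (@res_aug_surj _ _ P).
  have [|f1 f1P] := projective_lift (f := ch_comp f0 (res_d P 0)) (@res_proj _ _ P 1)
    (@res_exact0 _ _ Q).
    by move=> k x; rewrite /= f0P dd0.
  have [|g1 g1P] := projective_lift (f := ch_comp g0 (res_d Q 0)) (@res_proj _ _ Q 1)
    (@res_exact0 _ _ P).
    by move=> k x; rewrite /= g0P dd0.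
  have [|g2 g2P] := res_lift (S := P) (f := ch_comp g1 (res_d Q 1)) (@res_proj _ _ Q 2).
    by move=> k x; rewrite /= g1P /= dd raddf0.
  (* The homotopy starts from [g0 f0 - 1], which the augmentation kills because both maps lie over
     the identity of [X]. *)
  have [|h0 h0P] := projective_lift (f := ch_sub (ch_comp g0 f0) (ch_id (P 0)))
    (@res_proj _ _ P 0) (@res_exact0 _ _ P).
    by move=> k x; rewrite /= linearB /= g0P f0P subrr.
  have [|h1 h1P] := res_lift (S := P) (f := ch_sub (ch_sub (ch_comp g1 f1) (ch_id (P 1)))
    (ch_comp h0 (res_d P 0))) (@res_proj _ _ P 1).
    move=> k x; rewrite /= !linearB /= g1P /= f1P /= h0P /=.
    by rewrite subrr.
  exists f0, f1, g0, g1, g2, h0, h1; split=> k x; [exact: f1P|exact: g1P|exact: g2P|].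
  by rewrite h1P /= subrK.
have [|f2 f2P] := res_lift (S := Q) (f := ch_comp f1 (res_d P n.+1)) (@res_proj _ _ P n.+2).
  by move=> k x; rewrite /= df dd raddf0.
have [|g3 g3P] := res_lift (S := P) (f := ch_comp g2 (res_d Q n.+2)) (@res_proj _ _ Q n.+3).
  by move=> k x; rewrite /= dg' dd raddf0.
have [|h2 h2P] := res_lift (S := P) (f := ch_sub (ch_sub (ch_comp g2 f2) (ch_id (P n.+2)))
    (ch_comp h1 (res_d P n.+1))) (@res_proj _ _ P n.+2).
  move=> k x; rewrite /= !linearB /= dg' f2P /=.
  by rewrite gf dd raddf0 addr0 subrr.
exists f1, f2, g1, g2, g3, h1, h2; split=> k x; [exact: f2P|exact: dg'|exact: g3P|].
by rewrite h2P /= subrK.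
Qed.

End Comparison.

(** If [dt = 0], then [f1 t] is a cycle, say [f1 t = du]. Now [d (g2 u) = g1 (f1 t) = t + d (h1 t)],
    as the homotopy term [h0 (dt)] vanishes; so [t] is the image of [g2 u - h1 t]. *)
Lemma mid_exact_resolution (R : pzRingType) (X : chcomplex R^c) (P Q : proj_resolution X)
    (L : chcomplex R) n m :
  mid_exact (@tmap _ _ _ (res_d Q n.+1) L m) (@tmap _ _ _ (res_d Q n) L m) ->
  mid_exact (@tmap _ _ _ (res_d P n.+1) L m) (@tmap _ _ _ (res_d P n) L m).
Proof.
have [f0 [f1 [g0 [g1 [g2 [h0 [h1 [df dg dg' gf]]]]]]]] := res_comparison P Q n.
move=> Qex t dt; have [|u du] := Qex (tmap f1 t).
  rewrite -tmap_comp (tmap_eq (g := ch_comp f0 (res_d P n))); last exact: df.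
  by rewrite tmap_comp dt tmap_zero.
exists (tmap g2 u - tmap h1 t).
rewrite tmapB -!tmap_comp (tmap_eq (g := ch_comp g1 (res_d Q n.+1))); last exact: dg'.
rewrite tmap_comp du.
apply/eqP; rewrite subr_eq -tmap_comp; apply/eqP.
rewrite (tmap_add (f1 := ch_id (P n.+1))
  (f2 := ch_sub (ch_comp g1 f1) (ch_id (P n.+1)))); last first.
  by move=> k x; rewrite /= addrC subrK.
rewrite [tmap (ch_id _) t]tmap_id; last by [].
rewrite (tmap_add (f1 := ch_comp (res_d P n.+1) h1) (f2 := ch_comp h0 (res_d P n))); last exact: gf.
by rewrite (tmap_comp _ h0) dt tmap_zero addr0.
Qed.

(** The augmentation is left out because the resolved complex can be recovered as a cokernel; hence
    a chain with its first terms dropped is again a resolution of something. *)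
Record fp_chain (R : pzRingType) := FpChain {
  fpc_obj :> nat -> chcomplex R;
  fpc_d : forall i, chmap (fpc_obj i.+1) (fpc_obj i);
  fpc_proj : forall i, projective_cx (fpc_obj i);
  fpc_fg : forall i, fingen_cx (fpc_obj i);
  fpc_exact : forall i, exact_chmap (fpc_d i.+1) (fpc_d i)
}.

Section Level.
Context (R : pzRingType) (L : chcomplex R).

(** From degree [n] on the chain resolves the cokernel of [fpc_d P n], which is thereby of type
    $FP_\infty$; exactness at [P n.+1] is the vanishing of its $\overline{\mathrm{Tor}}_1$. *)
Lemma level_chain (P : fp_chain R^c) n m :
  level L -> mid_exact (@tmap _ _ _ (fpc_d P n.+1) L m) (@tmap _ _ _ (fpc_d P n) L m).
Proof.
move=> Llev.
pose S := @ProjResolution _ (coker (fpc_d P n)) (fun i => P (i + n)%N)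
  (fun i => fpc_d P (i + n)%N) (coker_pi (fpc_d P n)) (fun i => @fpc_proj _ P (i + n)%N)
  (@quotcx_pi_surj _ _ _ _) (coker_exact (fpc_d P n)) (fun i => @fpc_exact _ P (i + n)%N).
have fpX : FPinfty (coker (fpc_d P n)) by exists S => i; apply: fpc_fg.
have /torbar_vanishesE H := Llev _ fpX.
exact: (H S m).
Qed.

Lemma chain_level :
  (forall (P : fp_chain R^c) m,
     mid_exact (@tmap _ _ _ (fpc_d P 1) L m) (@tmap _ _ _ (fpc_d P 0) L m)) ->
  level L.
Proof.
move=> H X [Q Qfg]; apply/torbar_vanishesE => P m.
apply: (mid_exact_resolution (Q := Q)).
exact: (H (FpChain (@res_proj _ _ Q) Qfg (@res_exact _ _ Q)) m).
Qed.

Lemma level_torbar : level L -> forall n (X : chcomplex R^c), (0 < n)%N ->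
  FPinfty X -> torbar_vanishes n X L.
Proof.
move=> Llev [//|n] X _ [Q Qfg]; apply/torbar_vanishesE => P m.
apply: (mid_exact_resolution (Q := Q)).
exact: (@level_chain (FpChain (@res_proj _ _ Q) Qfg (@res_exact _ _ Q)) n m Llev).
Qed.

End Level.

(** * Closure properties *)

Section Closure.
Context (R : pzRingType).
Implicit Types (P : fp_chain R^c) (L X Y : chcomplex R).

Lemma tmap_fpc_dd P n L m (t : tensbar (P n.+2) L m) :
  tmap (fpc_d P n) (tmap (fpc_d P n.+1) t) = 0.
Proof. by rewrite -tmap_comp; apply: tmap0; apply/exact_comp0/fpc_exact. Qed.

(** * Extensions and kernels of epimorphisms *)

Section ShortExact.
Context (L' L L'' : chcomplex R) (f : chmap L' L) (g : chmap L L'').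
Hypothesis fg : short_exact f g.

Lemma tmapr_gf P n m (t : tensbar (P n) L' m) : tmapr (P n) g (tmapr (P n) f t) = 0.
Proof.
rewrite (tmapr_comp (k := ch_comp g f)); last by [].
by apply: tmapr0; apply: exact_comp0; case: fg.
Qed.

(** A cycle over [L] becomes a boundary over [L'']. Subtracting the boundary of a lift leaves an
    element that comes from [L']; it is a cycle there because [P 0] preserves the injectivity of
    [f]. *)
Lemma level_extension : level L' -> level L'' -> level L.
Proof.
have [finj fgex gsurj] := fg.
move=> L'lev L''lev; apply: chain_level => P m t dt.
have [|u'' du''] := @level_chain _ _ P 0 m L''lev (tmapr _ g t).
  by rewrite tmap_tmapr dt tmapr_zero.
have [u gu] := tmapr_surj (@fpc_proj _ P 2) (@fpc_fg _ P 2) u'' gsurj.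
have [|v fv] := tmapr_exact (t := t - tmap (fpc_d P 1) u) (@fpc_proj _ P 1)
  (@fpc_fg _ P 1) fgex.
  by rewrite tmaprB -tmap_tmapr gu du'' subrr.
have [|w dw] := @level_chain _ _ P 0 m L'lev v.
  apply: (tmapr_inj (@fpc_proj _ P 0) (@fpc_fg _ P 0) finj).
  by rewrite -tmap_tmapr fv tmapB dt tmap_fpc_dd subrr.
exists (u + tmapr _ f w).
by rewrite tmapD tmap_tmapr dw fv addrC subrK.
Qed.

(** This is the stretch $\overline{\mathrm{Tor}}_2(X, L'') \to \overline{\mathrm{Tor}}_1(X, L') \to
    \overline{\mathrm{Tor}}_1(X, L)$ of the long exact sequence, chased by hand; for this reason
    [level_chain] is applied to [L''] one degree higher. *)
Lemma level_kernel : level L -> level L'' -> level L'.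
Proof.
have [finj fgex gsurj] := fg.
move=> Llev L''lev; apply: chain_level => P m t dt.
have [|u du] := @level_chain _ _ P 0 m Llev (tmapr _ f t).
  by rewrite tmap_tmapr dt tmapr_zero.
have [|v'' dv''] := @level_chain _ _ P 1 m L''lev (tmapr _ g u).
  by rewrite tmap_tmapr du tmapr_gf.
have [v gv] := tmapr_surj (@fpc_proj _ P 3) (@fpc_fg _ P 3) v'' gsurj.
have [|w fw] := tmapr_exact (t := u - tmap (fpc_d P 2) v) (@fpc_proj _ P 2)
  (@fpc_fg _ P 2) fgex.
  by rewrite tmaprB -tmap_tmapr gv dv'' subrr.
exists w; apply/eqP; rewrite -subr_eq0; apply/eqP.
apply: (tmapr_inj (@fpc_proj _ P 1) (@fpc_fg _ P 1) finj).
by rewrite tmaprB -tmap_tmapr fw tmapB tmap_fpc_dd subr0 du subrr.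
Qed.

End ShortExact.

Lemma level_retract X L : retract X L -> level L -> level X.
Proof.
move=> [i [r ri]] Llev; apply: chain_level => P m t dt.
have [|u du] := @level_chain _ _ P 0 m Llev (tmapr _ i t).
  by rewrite tmap_tmapr dt tmapr_zero.
exists (tmapr _ r u); rewrite tmap_tmapr du (tmapr_comp (k := ch_id X)); last exact: ri.
exact: tmapr_id.
Qed.

(** * Products and coproducts *)

Section Product.
Context (I : Type) (L : I -> chcomplex R) (X : chcomplex R).
Context (p : forall i, chmap X (L i)) (pP : is_product p).

(** As maps from $D^k(R)$, the element [x] and zero have the same components, so the uniqueness
    clause identifies them. The existence clause likewise yields [product_surj]. *)
Lemma product_inj k (x : X k) : (forall i, p i k x = 0) -> x = 0.
Proof.
move=> px; have [u [_ uU]] := pP (fun i => ch_zero (disk R k) (L i)).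
have xu : eq_chmap (disk_map x) u.
  apply: uU => i; apply: (disk_ext (f := ch_comp (p i) (disk_map x))
    (g := ch_zero (disk R k) (L i))).
  by rewrite -[LHS]/(p i k (disk_map x k (disk_gen R k))) disk_map_gen px.
have zu : eq_chmap (ch_zero (disk R k) X) u by apply: uU => i n y; rewrite /= raddf0.
by rewrite -(disk_map_gen x) xu -zu.
Qed.

Lemma product_surj k (y : forall i, L i k) : exists x, forall i, p i k x = y i.
Proof.
have [u [uP _]] := pP (fun i => disk_map (y i)).
by exists (u k (disk_gen R k)) => i; rewrite uP disk_map_gen.
Qed.

(** The preimages [u i] live over different factors. For each of the finitely many coordinates,
    their values form a family indexed by [i], hence an element of [X], and these elements are
    recombined. *)
Lemma level_product : (forall i, level (L i)) -> level X.
Proof.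
move=> Llev; apply: chain_level => P m t dt.
have uP i : exists u, tmap (fpc_d P 1) u = tmapr _ (p i) t.
  apply: (@level_chain _ _ P 0 m (Llev i)).
  by rewrite tmap_tmapr dt tmapr_zero.
have [u du] := dep_choice uP.
have [c] := coordinates_exist m (@fpc_proj _ P 2) (@fpc_fg _ P 2).
have [x xP] := dep_choice (fun k : co_idx c => product_surj (fun i => co_coef k (u i))).
exists (\sum_k co_tens (x k)); apply/eqP; rewrite -subr_eq0; apply/eqP.
have [c1] := coordinates_exist m (@fpc_proj _ P 1) (@fpc_fg _ P 1).
apply: (co_eq0 (c := c1)) => k; apply: product_inj => i.
rewrite -co_coef_nat tmaprB -tmap_tmapr tmapr_sum -du.
under eq_bigr => l _ do rewrite co_tens_nat xP.
by rewrite co_decomp subrr co_coef0.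
Qed.

End Product.

Section Coproduct.
Context (I : choiceType) (L : I -> chcomplex R) (X : chcomplex R).
Context (s : forall i, chmap (L i) X) (sP : is_coproduct s).

Lemma coproduct_proj : exists p : forall i, chmap X (L i),
  forall i j n (x : L i n), p j n (s i n x) = kron L i j n x.
Proof.
have [p pP] := dep_choice (fun j => sP (fun i => kron L i j)).
by exists p => i j n x; case: (pP j) => + _; apply.
Qed.

(** Elements that are finite sums of their components form a subcomplex containing the image of
    every [s i]; uniqueness for maps into the quotient makes it all of [X]. Quantifying over every
    duplicate-free list [S'] that contains [S] lets several elements share one list. *)
Lemma coproduct_finite (p : forall i, chmap X (L i)) :
  (forall i j n (x : L i n), p j n (s i n x) = kron L i j n x) ->
  forall n (x : X n), exists S : seq I, forall S' : seq I, uniq S' -> {subset S <= S'} ->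
    \sum_(i <- S') s i n (p i n x) = x.
Proof.
move=> ps.
pose E n (x : X n) := exists S : seq I, forall S' : seq I, uniq S' -> {subset S <= S'} ->
    \sum_(i <- S') s i n (p i n x) = x.
have E0 n : E n 0 by exists [::] => S' _ _; rewrite big1 // => i _; rewrite !raddf0.
have EL n (a : R) (x y : X n) : E n x -> E n y -> E n (a *: x + y).
  move=> [S SP] [T TP]; exists (S ++ T) => S' uS' sub.
  under eq_bigr => i _ do rewrite !linearP.
  rewrite big_split /= -scaler_sumr SP ?TP // => i iS; apply: sub;
    by rewrite mem_cat iS ?orbT.
pose ES n := submod_of_Prop (E0 n) (EL n).
have dE i j (h : j + 1 = i) x : x \in ES i -> ch_d X h x \in ES j.
  move=> /asboolP[S SP]; apply/asboolP; exists S => S' uS' sub.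
  under eq_bigr => k _ do rewrite !ch_funP.
  by rewrite -raddf_sum SP.
have [u [uP uU]] := sP (fun i => ch_zero (L i) (quotcx dE)).
have pi0 : eq_chmap (quotcx_pi dE) u.
  apply: uU => i n x /=; apply/quotmod_pi_eq0/asboolP; exists [:: i] => S' uS' sub.
  have iS' : i \in S' by apply: sub; rewrite mem_head.
  rewrite (bigD1_seq i) //= ps kron_id big1 ?addr0 // => j /eqP ji.
  by rewrite ps kron_neq ?raddf0 // => /esym.
have z0 : eq_chmap (ch_zero X (quotcx dE)) u by apply: uU.
move=> n x; suff /quotcx_pi_eq0/asboolP : quotcx_pi dE n x = 0 by [].
by rewrite pi0 -z0.
Qed.

Lemma level_coproduct_choice : (forall i, level (L i)) -> level X.
Proof.
move=> Llev; apply: chain_level => P m t dt.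
have [p ps] := coproduct_proj.
have uP i : exists u, tmap (fpc_d P 1) u = tmapr _ (p i) t.
  apply: (@level_chain _ _ P 0 m (Llev i)).
  by rewrite tmap_tmapr dt tmapr_zero.
have [u du] := dep_choice uP.
have [c] := coordinates_exist m (@fpc_proj _ P 1) (@fpc_fg _ P 1).
have [S SP] := dep_choice (fun k : co_idx c => coproduct_finite ps (co_coef k t)).
(* A single finite list of indices that serves all coordinates of [t] at once. *)
pose S' := undup (flatten [seq S k | k <- enum (co_idx c)]).
exists (\sum_(i <- S') tmapr _ (s i) (u i)).
rewrite tmap_sum; under eq_bigr => i _ do rewrite tmap_tmapr du.
apply/eqP; rewrite -subr_eq0; apply/eqP; apply: (co_eq0 (c := c)) => k.
rewrite co_coefB co_coef_sum.
under eq_bigr => i _ do rewrite !co_coef_nat.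
rewrite SP ?subrr ?undup_uniq // => i iS; rewrite mem_undup.
by apply/flatten_mapP; exists k; rewrite ?mem_enum.
Qed.

End Coproduct.

(** The finite index lists and [kron] compare indices; [{classic I}] supplies this for an arbitrary
    type. *)
Lemma level_coproduct (I : Type) (L : I -> chcomplex R) X (s : forall i, chmap (L i) X) :
  is_coproduct s -> (forall i, level (L i)) -> level X.
Proof. exact: (@level_coproduct_choice {classic I}). Qed.

(** In degree [m], tensoring the chain with the disk gives back its graded piece of degree [m - q],
    where it is exact by hypothesis. *)
Lemma level_disk q : level (disk R q).
Proof.
apply: chain_level => P m t dt.
have coef_nat i (x : P i.+1 (m - q)) :
    tmap (fpc_d P i) (codisk_tens x) = codisk_tens (fpc_d P i _ x).
  by rewrite /codisk_tens tmapE.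
have tE := codisk_tensK t; set x := codisk_coef _ _ _ t in tE.
have [|y yx] := (@fpc_exact _ P 0 (m - q) x).1.
  by rewrite -[LHS]codisk_coefK -coef_nat tE dt raddf0.
by exists (codisk_tens y); rewrite coef_nat yx.
Qed.

Lemma level_projective X : projective_cx X -> level X.
Proof.
(* One disk for each homogeneous element of [X], so that their sum maps onto [X] and the map
   splits. *)
move=> Xproj; pose G : choiceType := {classic {n & X n}}.
pose L (g : G) := disk R (tag (g : {n & X n})).
pose f (g : G) : chmap (L g) X := disk_map (tagged (g : {n & X n})).
have fsurj : surjective_chmap (sumcx_lift f).
  move=> n x; pose g : G := Tagged (fun n => X n) x.
  by exists (sumcx_inj L g n (disk_gen R n)); rewrite sumcx_liftE; apply: disk_map_gen.
have [s sP] := Xproj _ _ _ (ch_id X) fsurj.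
apply: (@level_retract _ (sumcx L)).
  by exists s, (sumcx_lift f).
apply: (level_coproduct (@sumcx_is_coproduct _ _ L)) => g; exact: level_disk.
Qed.

End Closure.

(** * Purity and direct limits *)

Section Purity.
Context (R : pzRingType) (P1 P0 : chcomplex R^c) (d : chmap P1 P0) (m : int).
Context (c1 : coordinates P1 m) (c0 : coordinates P0 m).
Local Notation U := (fun k : co_idx c1 => disk R (co_deg k)).
Local Notation V := (fun l : co_idx c0 => disk R (co_deg l)).

(** In coordinates [d] is a natural transformation between finite products of
    terms of a complex; by the Yoneda lemma it comes from the map [dual_map]
    of left complexes. *)
Definition dual_elt (k : co_idx c1) (l : co_idx c0) : U k (co_deg l) :=
  co_coef l (tmap d (co_tens (disk_gen R (co_deg k)))).

Definition dual_map : chmap (prodcx V) (prodcx U) :=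
  ch_sum (fun l => ch_comp (prodcx_lift (fun k => disk_map (dual_elt k l)))
                           (prodcx_proj V l)).

Definition prod_disk_map (Y : chcomplex R) (y : forall k : co_idx c1, Y (co_deg k)) :
    chmap (prodcx U) Y :=
  ch_sum (fun k => ch_comp (disk_map (y k)) (prodcx_proj U k)).

Lemma prod_disk_map_gen (Y : chcomplex R) (y : forall k : co_idx c1, Y (co_deg k)) k :
  prod_disk_map y _ (prodcx_inj U k _ (disk_gen R _)) = y k.
Proof. by rewrite /prod_disk_map prodcx_sum_inj; apply: disk_map_gen. Qed.

Lemma prod_disk_ext (T : finType) (q : T -> int) (Y : chcomplex R)
    (f g : chmap (prodcx (fun t => disk R (q t))) Y) :
  (forall t, f _ (prodcx_inj _ t _ (disk_gen R (q t)))
           = g _ (prodcx_inj _ t _ (disk_gen R (q t)))) ->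
  eq_chmap f g.
Proof.
move=> fg n x; rewrite [x]prodcx_sum !linear_sum; apply: eq_bigr => t _.
exact: (disk_ext (f := ch_comp f (prodcx_inj _ t)) (g := ch_comp g (prodcx_inj _ t)) (fg t)).
Qed.

(** The Yoneda step: [dual_elt] records the value of [d] at the universal element, the generator of
    a disk, and naturality along [disk_map (y k)] carries it to [y k]. *)
Lemma dual_map_gen (Y : chcomplex R) (y : forall k : co_idx c1, Y (co_deg k)) l :
  prod_disk_map y _ (dual_map _ (prodcx_inj V l _ (disk_gen R _)))
    = co_coef l (tmap d (\sum_k co_tens (y k))).
Proof.
rewrite /dual_map prodcx_sum_inj tmap_sum co_coef_sum /=.
apply: eq_bigr => k _.
rewrite -[LHS]/(disk_map (y k) _ (disk_map (dual_elt k l) _ (disk_gen R _))).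
rewrite disk_map_gen /dual_elt -co_coef_nat -tmap_tmapr co_tens_nat.
by rewrite disk_map_gen.
Qed.

(** So the families of coordinates that [d] kills are the maps from the cokernel of [dual_map] to
    [Y]. *)
Lemma dual_map_comp0 (Y : chcomplex R) (y : forall k : co_idx c1, Y (co_deg k)) :
  comp_is0 (prod_disk_map y) dual_map <-> tmap d (\sum_k co_tens (y k)) = 0.
Proof.
split=> [y0|y0 n x].
  by apply: (co_eq0 (c := c0)) => l; rewrite -dual_map_gen y0.
apply: (prod_disk_ext (f := ch_comp (prod_disk_map y) dual_map) (g := ch_zero _ _)) => l.
by rewrite /= [LHS]dual_map_gen y0 co_coef0.
Qed.

Lemma dual_coker_finpres : finpres_cx (coker dual_map).
Proof.
exists (prodcx V), (prodcx U), dual_map, (coker_pi dual_map); split.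
- split; first by apply: prodcx_projective => l; apply: disk_projective.
  by apply: prodcx_fingen => l; apply: disk_fingen.
- split; first by apply: prodcx_projective => k; apply: disk_projective.
  by apply: prodcx_fingen => k; apply: disk_fingen.
- exact: coker_exact.
exact: quotcx_pi_surj.
Qed.

End Purity.

Section PureClosure.
Context (R : pzRingType) (A L Q : chcomplex R) (i : chmap A L) (p : chmap L Q).
Hypothesis ip : pure_exact i p.

(** Over [Q] the coordinates of [t] are killed by [d], because [dt] comes from [A]; they define a
    map from the cokernel to [Q]. Its lift to [L] is a family [y'] still killed by [d], and [y - y']
    has the same image under [d] as [t] but vanishes in [Q], so it comes from [A]. *)
Lemma pure_tensor (P1 P0 : chcomplex R^c) (d : chmap P1 P0) m :
  projective_cx P1 -> fingen_cx P1 -> projective_cx P0 -> fingen_cx P0 ->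
  forall (a : tensbar P0 A m) (t : tensbar P1 L m), tmapr P0 i a = tmap d t ->
  exists b, tmap d b = a.
Proof.
move=> P1proj P1fg P0proj P0fg a t it.
have [c1] := coordinates_exist m P1proj P1fg.
have [c0] := coordinates_exist m P0proj P0fg.
have [[iinj ipex psurj] pure] := ip.
pose y (k : co_idx c1) : L (co_deg k) := co_coef k t.
pose z k : Q _ := p _ (y k).
have z0 : comp_is0 (prod_disk_map z) (dual_map d c1 c0).
  apply/dual_map_comp0.
  under eq_bigr => k _ do rewrite -co_tens_nat.
  rewrite -tmapr_sum co_decomp tmap_tmapr -it.
  rewrite (tmapr_comp (k := ch_comp p i)); last by [].
  by apply: tmapr0; apply: exact_comp0.
have [_ _ lift] := pure _ (dual_coker_finpres d c1 c0).
have [v vP] := lift (coker_lift z0).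
pose y' (k : co_idx c1) : L (co_deg k) :=
  v _ (coker_pi (dual_map d c1 c0) _ (prodcx_inj _ k _ (disk_gen R _))).
have y'E : eq_chmap (prod_disk_map y') (ch_comp v (coker_pi (dual_map d c1 c0))).
  by apply: prod_disk_ext => k; rewrite prod_disk_map_gen.
have y'0 : tmap d (\sum_k co_tens (y' k)) = 0.
  apply/(dual_map_comp0 d c0) => n x; rewrite y'E /=.
  rewrite -[X in v n X](_ : 0 = _) ?raddf0 //; apply/esym.
  by apply/(@coker_exact _ _ _ (dual_map d c1 c0)); exists x.
have bP k : exists b, i _ b = y k - y' k.
  apply/ipex; rewrite linearB /= /y' vP coker_liftE.
  by rewrite prod_disk_map_gen subrr.
have [b ib] := dep_choice bP.
exists (\sum_k co_tens (b k)); apply/eqP; rewrite -subr_eq0; apply/eqP.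
apply: (tmapr_inj P0proj P0fg iinj).
rewrite tmaprB -tmap_tmapr tmapr_sum it.
under eq_bigr => k _ do rewrite co_tens_nat ib co_tensB.
by rewrite sumrB tmapB y'0 subr0 co_decomp subrr.
Qed.

(** A cycle over [Q] lifts to [l] over [L], with [dl] coming from [A]. By purity [dl] is already the
    image of an element of $P_1 \overline{\otimes} A$, and subtracting it turns [l] into a cycle
    without changing its image over [Q]. *)
Lemma level_pure_quotient : level L -> level Q.
Proof.
have [[iinj ipex psurj] _] := ip.
move=> Llev; apply: chain_level => P m t dt.
have [l pl] := tmapr_surj (@fpc_proj _ P 1) (@fpc_fg _ P 1) t psurj.
have [|a ia] := tmapr_exact (t := tmap (fpc_d P 0) l) (@fpc_proj _ P 0)
  (@fpc_fg _ P 0) ipex.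
  by rewrite -tmap_tmapr pl.
have [b db] := pure_tensor (@fpc_proj _ P 1) (@fpc_fg _ P 1) (@fpc_proj _ P 0)
  (@fpc_fg _ P 0) ia.
have [|u du] := @level_chain _ _ P 0 m Llev (l - tmapr _ i b).
  by rewrite tmapB tmap_tmapr db ia subrr.
exists (tmapr _ p u); rewrite tmap_tmapr du tmaprB pl.
rewrite (tmapr_comp (k := ch_comp p i)); last by [].
by rewrite [X in _ - X]tmapr0 ?subr0 //; apply: exact_comp0.
Qed.

(** The quotient being level, [A] is the kernel of an epimorphism of level complexes. *)
Lemma level_pure_sub : level L -> level A.
Proof. by move=> Llev; apply: (level_kernel ip.1) => //; apply: level_pure_quotient. Qed.

End PureClosure.

(** * Colimits over a directed subset of a preorder *)

Section DirectLimit.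
Context (R : pzRingType) (d : Order.disp_t) (I : preorderType d) (D : diagram R I).
Context (S : {pred I}) (X : chcomplex R) (c : forall i, i \in S -> chmap (D i) X).
Hypothesis cP : is_colimit_on c.
Hypothesis S_inhabited : exists i, i \in S.
Hypothesis S_directed : forall i j, i \in S -> j \in S ->
  exists k, [/\ k \in S, (i <= k)%O & (j <= k)%O].

(** Directedness makes the elements that come from some stage a subcomplex. The projection modulo it
    and the zero map extend the same zero cocone, so they coincide. *)
Lemma colimit_surj n (x : X n) : exists i (Si : i \in S) y, c Si n y = x.
Proof.
have [cc cU] := cP.
pose E n (x : X n) := exists i (Si : i \in S) y, c Si n y = x.
have E0 k : E k 0 by have [i Si] := S_inhabited; exists i, Si, 0; rewrite raddf0.
have EL k (a : R) (u v : X k) : E k u -> E k v -> E k (a *: u + v).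
  move=> [i [Si [y <-]]] [j [Sj [z <-]]]; have [l [Sl il jl]] := S_directed Si Sj.
  exists l, Sl, (a *: dg_map D il k y + dg_map D jl k z).
  by rewrite linearP (cc _ _ Si Sl il) (cc _ _ Sj Sl jl).
pose ES k := submod_of_Prop (E0 k) (EL k).
have dE i j (h : j + 1 = i) u : u \in ES i -> ch_d X h u \in ES j.
  move=> /asboolP[k [Sk [y <-]]]; apply/asboolP; exists k, Sk, (ch_d _ h y).
  by rewrite ch_funP.
have zc : cocone_on (fun i (_ : i \in S) => ch_zero (D i) (quotcx dE)) by [].
have [u [uP uU]] := cU _ _ zc.
have pi0 : eq_chmap (quotcx_pi dE) u.
  by apply: uU => i Si k y; apply/quotmod_pi_eq0/asboolP; exists i, Si, y.
have z0 : eq_chmap (ch_zero X (quotcx dE)) u by apply: uU.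
suff /quotcx_pi_eq0/asboolP : quotcx_pi dE n x = 0 by [].
by rewrite pi0 -z0.
Qed.

(** The value zero where [i <= j] fails is a filler that allows a map from [D i] into the product of
    all stages; the reduced product forgets it. *)
Definition dg_tot i j : chmap (D i) (D j) :=
  match @idP (i <= j)%O with
  | ReflectT h => dg_map D h
  | ReflectF _ => ch_zero (D i) (D j)
  end.

Lemma dg_totE i j (h : (i <= j)%O) : dg_tot i j = dg_map D h.
Proof. by rewrite /dg_tot; case: {-}_ / idP => // h'; rewrite (bool_irrelevance h' h). Qed.

(** The colimit maps to the reduced product of the diagram, in which an element
    of [D i] vanishes only if it already does in some [D j]. *)
Lemma colimit_ker i (Si : i \in S) n (y : D i n) :
  c Si n y = 0 -> exists j (h : (i <= j)%O), j \in S /\ dg_map D h n y = 0.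
Proof.
have [cc cU] := cP.
pose F := prodcx (fun j => D j).
pose E n (f : F n) := exists2 k, k \in S & forall j, j \in S -> (k <= j)%O ->
  prodcx_proj _ j n f = 0.
have E0 k : E k 0 by have [l Sl] := S_inhabited; exists l => // j _ _; rewrite raddf0.
have EL k (a : R) (u v : F k) : E k u -> E k v -> E k (a *: u + v).
  move=> [l Sl u0] [l' Sl' v0]; have [k' [Sk' lk l'k]] := S_directed Sl Sl'.
  exists k' => // j Sj kj; rewrite linearP u0 ?v0 ?scaler0 ?addr0 //.
    exact: le_trans kj.
  exact: le_trans kj.
pose ES k := submod_of_Prop (E0 k) (EL k).
have dE k j (h : j + 1 = k) u : u \in ES k -> ch_d F h u \in ES j.
  move=> /asboolP[l Sl ul]; apply/asboolP; exists l => // l' Sl' ll'.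
  by rewrite ch_funP ul // raddf0.
pose t k (_ : k \in S) := ch_comp (quotcx_pi dE) (prodcx_lift (fun j => dg_tot k j)).
have tc : cocone_on t.
  move=> k j Sk Sj kj l u.
  pose v := prodcx_lift (dg_tot j) l (dg_map D kj l u); pose w := prodcx_lift (dg_tot k) l u.
  change (quotcx_pi dE l v = quotcx_pi dE l w).
  (* The two families may differ at indices not above [j], but they agree from [j] on, by
     functoriality. *)
  apply/eqP; rewrite -subr_eq0 -linearB; apply/eqP.
  apply/quotcx_pi_eq0/asboolP; exists j => // j' Sj' jj'.
  rewrite linearB !prodcx_liftE (dg_totE jj') (dg_totE (le_trans kj jj')).
  by rewrite (dg_comp kj jj' (le_trans kj jj')) subrr.
have [u [uP _]] := cU _ t tc => cy.
have /quotcx_pi_eq0/asboolP[k Sk ky] : t i Si n y = 0 by rewrite -uP cy raddf0.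
have [j [Sj ij kj]] := S_directed Si Sk.
exists j, ij; split=> //.
by have := ky j Sj kj; rewrite prodcx_liftE (dg_totE ij).
Qed.

Lemma directed_finite (T : finType) (f : T -> I) : (forall t, f t \in S) ->
  exists2 k, k \in S & forall t, (f t <= k)%O.
Proof.
move=> fS; suff [k Sk fk] : exists2 k, k \in S & forall t, t \in enum T -> (f t <= k)%O.
  by exists k => // t; apply: fk; rewrite mem_enum.
elim: (enum T) => [|t s [k Sk fk]]; first by have [i Si] := S_inhabited; exists i.
have [l [Sl tl kl]] := S_directed (fS t) Sk; exists l => // u.
by rewrite inE => /predU1P[-> //|/fk uk]; apply: le_trans kl.
Qed.

Lemma tmapr_colimit_surj (P : chcomplex R^c) m (t : tensbar P X m) :
  exists i (Si : i \in S) u, tmapr P (c Si) u = t.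
Proof.
have [cc _] := cP.
elim/tensbar_ind: t => [|a b [i [Si [u <-]]] [j [Sj [v <-]]]|i j h x y].
- by have [i Si] := S_inhabited; exists i, Si, 0; rewrite tmapr_zero.
- have [k [Sk ik jk]] := S_directed Si Sj.
  exists k, Sk, (tmapr P (dg_map D ik) u - tmapr P (dg_map D jk) v).
  by rewrite tmaprB !(tmapr_comp (cc _ _ _ Sk _)).
have [k [Sk [z <-]]] := colimit_surj y.
by exists k, Sk, (tb h x z); rewrite tmaprE.
Qed.

(** Each coordinate of [t] dies at some stage; there are finitely many coordinates, so one later
    stage kills them all. *)
Lemma tmapr_colimit_ker (P : chcomplex R^c) m i (Si : i \in S) (t : tensbar P (D i) m) :
  projective_cx P -> fingen_cx P -> tmapr P (c Si) t = 0 ->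
  exists j (h : (i <= j)%O), j \in S /\ tmapr P (dg_map D h) t = 0.
Proof.
move=> Pproj Pfg ct; have [q] := coordinates_exist m Pproj Pfg.
have kP (k : co_idx q) : exists j, j \in S /\
    exists h : (i <= j)%O, dg_map D h _ (co_coef k t) = 0.
  have [|j [h [Sj jt]]] := @colimit_ker i Si _ (co_coef k t).
    by rewrite -co_coef_nat ct co_coef0.
  by exists j; split; last exists h.
have [f fP] := dep_choice kP.
have [j Sj fj] := directed_finite (fun k => (fP k).1).
have [l [Sl il jl]] := S_directed Si Sj.
exists l, il; split=> //; apply: (co_eq0 (c := q)) => k.
rewrite co_coef_nat; have [_ [h hk]] := fP k.
by rewrite -(dg_comp h (le_trans (fj k) jl) il) hk raddf0.
Qed.

(** A cycle over [X] comes from a stage, where it need not be a cycle, but it becomes one at a later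
    stage. Working over a subset [S] covers both direct limits and the limit steps of a transfinite
    extension. *)
Lemma level_colimit_on : (forall i, i \in S -> level (D i)) -> level X.
Proof.
have [cc _] := cP.
move=> Dlev; apply: chain_level => P m t.
have [i [Si [v <-]]] := tmapr_colimit_surj t; rewrite tmap_tmapr => dv.
have [j [ij [Sj jv]]] := tmapr_colimit_ker (@fpc_proj _ P 0) (@fpc_fg _ P 0) dv.
have [|u du] := @level_chain _ _ P 0 m (Dlev j Sj) (tmapr _ (dg_map D ij) v).
  by rewrite tmap_tmapr.
exists (tmapr _ (c Sj) u); rewrite tmap_tmapr du.
exact: tmapr_comp (cc _ _ _ _ _) _ _.
Qed.

End DirectLimit.

Lemma level_direct_limit (R : pzRingType) (d : Order.disp_t) (I : preorderType d)
    (D : diagram R I) (X : chcomplex R) :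
  directed I -> is_colimit D X -> (forall i, level (D i)) -> level X.
Proof.
move=> [[i0] Idir] [c cP] Dlev; apply: (level_colimit_on cP) => //; first by exists i0.
by move=> i j _ _; have [k [ik jk]] := Idir i j; exists k.
Qed.

(** * Transfinite extensions *)

Section Transfinite.
Context (R : pzRingType) (d : Order.disp_t) (I : orderType d) (D : diagram R I).
Hypothesis I_wo : well_order (<=%O : rel I).
Hypothesis D_least : exists i0 : I, is_least i0 /\ level (D i0).
Hypothesis D_limit : colimit_preserving D.
Hypothesis D_succ : forall (i j : I) (h : (i <= j)%O), is_succ i j ->
  exists (Q : chcomplex R) (q : chmap (D j) Q), short_exact (dg_map D h) q /\ level Q.

(** At the least stage that is not level, the limit case is excluded by colimits of the earlier
    stages and the successor case by closure under extensions. *)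
Lemma level_transfinite_stage i : level (D i).
Proof.
apply: contrapT => iN.
have [|z [[/asboolP zN zmin] _]] := I_wo (A := fun k => `[< ~ level (D k) >]).
  by exists i; apply/asboolP.
have lev j : (j < z)%O -> level (D j).
  move=> jz; apply: contrapT => jN.
  by have /(_ (introT (asboolP _) jN)) := zmin j; rewrite leNgt jz.
apply: zN; have [i0 [i0least i0lev]] := D_least.
have [<- //|/eqP i0z] := eqVneq i0 z.
have {}i0z : (i0 < z)%O by rewrite lt_neqAle i0least andbT; apply/eqP.
have [zlim|zN] := EM (is_limit z).
  apply: (level_colimit_on (D_limit zlim)) => [|j k jz kz|j]; first by exists i0.
    by exists (Order.max j k); rewrite !le_max !lexx orbT inE gt_max [(j < z)%O]jz [(k < z)%O]kz.
  exact: lev.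
have [j jz jsucc] : exists2 j, (j < z)%O & forall k, (j < k)%O -> (z <= k)%O.
  apply: contrapT => H; apply: zN; split; first by exists i0.
  move=> j jz; apply: contrapT => H'; apply: H; exists j => // k jk.
  by rewrite leNgt; apply/negP => kz; apply: H'; exists k.
have [Q [q [ex Qlev]]] := D_succ (ltW jz) (conj jz jsucc).
exact: level_extension ex (lev j jz) Qlev.
Qed.

End Transfinite.

Lemma level_transfinite_extension (R : pzRingType) (X : chcomplex R) :
  transfinite_extension (@level R) X -> level X.
Proof.
move=> [d [I [D [I_wo D_least D_limit D_succ DX]]]].
apply: (level_direct_limit _ DX); last exact: level_transfinite_stage.
have [i0 _] := D_least; split=> // i j.
by exists (Order.max i j); rewrite !le_max !lexx orbT.
Qed.

Theorem proposition4p8 (R : pzRingType) :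
  (forall L : chcomplex R, level L ->
     forall (n : nat) (X : chcomplex R^c), (0 < n)%N -> FPinfty X ->
       torbar_vanishes n X L) /\
  (forall (P L Q : chcomplex R) (i : chmap P L) (p : chmap L Q),
     pure_exact i p -> level L -> level P /\ level Q) /\
  ((forall P : chcomplex R, projective_cx P -> level P) /\
   (forall (L' L L'' : chcomplex R) (f : chmap L' L) (g : chmap L L''),
      short_exact f g -> level L' -> level L'' -> level L) /\
   (forall (L' L L'' : chcomplex R) (f : chmap L' L) (g : chmap L L''),
      short_exact f g -> level L -> level L'' -> level L')) /\
  ((forall (I : Type) (L : I -> chcomplex R) (X : chcomplex R)
      (p : forall i, chmap X (L i)),
      is_product p -> (forall i, level (L i)) -> level X) /\
   (forall (I : Type) (L : I -> chcomplex R) (X : chcomplex R)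
      (s : forall i, chmap (L i) X),
      is_coproduct s -> (forall i, level (L i)) -> level X) /\
   (forall X L : chcomplex R, retract X L -> level L -> level X) /\
   (forall (d : Order.disp_t) (I : preorderType d) (D : diagram R I)
      (X : chcomplex R),
      directed I -> is_colimit D X -> (forall i, level (D i)) -> level X) /\
   (forall X : chcomplex R,
      transfinite_extension (@level R) X -> level X)).
Proof.
split=> [L Llev n X n0 fpX|]; first exact: level_torbar Llev n X n0 fpX.
split=> [P L Q i p ip Llev|].
  by split; [exact: level_pure_sub ip Llev|exact: level_pure_quotient ip Llev].
split; first split; [exact: level_projective|split|].
- by move=> L' L L'' f g fg; apply: level_extension fg.
- by move=> L' L L'' f g fg; apply: level_kernel fg.
split=> [I L X p|]; first exact: level_product.
split=> [I L X s|]; first exact: level_coproduct.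
split; first exact: level_retract.
split; first exact: level_direct_limit.
exact: level_transfinite_extension.
Qed.
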